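(* Let $p\ge 7$ be a prime with $p\equiv 3 \pmod 4$ and let $k=\frac{p+1}{2}$. Then $$P[\mathscr{C}_k\theta_{\mathbb{Z}}](j)\equiv W_{n_k}^{b_k}(j) \mod p$$ as polynomials in $j$.
   Context: $M_k$ is the $\mathbb{Q}$-vector space of modular forms of weight $k$ for $\mathrm{SL}_2(\mathbb{Z})$ with rational $q$-expansion, $q=e^{2\pi i\tau}$. $E_k=1-\frac{2k}{B_k}\sum_{n\ge1}\bigl(\sum_{d\mid n}d^{k-1}\bigr)q^n$ is the Eisenstein series, $\Delta=\frac{1}{1728}(E_4^3-E_6^2)=q\prod_{n\ge1}(1-q^n)^{24}$, and $j=E_4^3/\Delta$. Every even $k\ge4$ is written uniquely as $k=12n_k+4a_k+6b_k$ with $n_k\in\mathbb{Z}_{\ge0}$, $a_k\in\{0,1,2\}$, $b_k\in\{0,1\}$. For $f\in M_k$, $P[f]\in\mathbb{Q}[j]$ is the unique polynomial (of degree $\le n_k$) with $\frac{f(\tau)}{\Delta(\tau)^{n_k}E_4(\tau)^{a_k}E_6(\tau)^{b_k}}=P[f](j(\tau))$. For a power series $f(q)$ and even $k\ge4$, $\mathscr{C}_kf$ is the unique modular form of weight $k$ for $\mathrm{SL}_2(\mathbb{Z})$ with $\mathscr{C}_kf-f=\mathcal{O}(q^{n_k+1})$. The Jacobi theta series is $\theta_{\mathbb{Z}}=\sum_{n\in\mathbb{Z}}q^{n^2}$; $P[\mathscr{C}_k\theta_{\mathbb{Z}}]$ has integer coefficients. With ${}_2F_1(\alpha,\beta;\gamma;z)=\sum_{n\ge0}\frac{(\alpha)_n(\beta)_n}{(\gamma)_n}\frac{z^n}{n!}$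 and $(x)_n=x(x+1)\cdots(x+n-1)$, $(x)_0=1$, the polynomials $W_n^0(j),W_n^1(j)$ ($n\ge0$) are the unique polynomials of degree $n$ satisfying $$j^n\cdot{}_2F_1\left(-\tfrac{1}{24},\tfrac{7}{24};\tfrac34;\tfrac{1728}{j}\right)=W_n^0(j)+\mathcal{O}(1/j),\qquad j^n\cdot{}_2F_1\left(\tfrac{11}{24},\tfrac{19}{24};\tfrac34;\tfrac{1728}{j}\right)=W_n^1(j)+\mathcal{O}(1/j),$$ i.e. the polynomial parts of these expansions in $1/j$. Congruence of polynomials with $p$-integral coefficients means coefficientwise congruence modulo $p$. *)

(* Defs.v *)
From HB Require Import structures.
From mathcomp Require Import all_boot all_order all_algebra.
From mathcomp Require Import zify complex.
From mathcomp Require Import boolp classical_sets reals topology normedtype.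
From mathcomp Require Import sequences derive exp trigo.

Set Implicit Arguments.
Unset Strict Implicit.
Unset Printing Implicit Defensive.

Import Order.TTheory GRing.Theory Num.Theory.
Import numFieldNormedType.Exports.
Local Open Scope classical_set_scope.
Local Open Scope ring_scope.

(* The exponents of k = 12 n_k + 4 a_k + 6 b_k, obtained from
   k / 2 = 2 (3 n_k + a_k) + 3 b_k; see [weight_decomp] and
   [weight_decomp_uniq].  Only meaningful for even k >= 4. *)
Definition wt_b (k : nat) : nat := (k %/ 2 %% 2)%N.
Definition wt_a (k : nat) : nat := ((k - 6 * wt_b k) %/ 4 %% 3)%N.
Definition wt_n (k : nat) : nat := ((k - 6 * wt_b k) %/ 12)%N.

Lemma weight_decomp k : ~~ odd k -> (4 <= k)%N ->
  [/\ (k = 12 * wt_n k + 4 * wt_a k + 6 * wt_b k)%N,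
      (wt_a k <= 2)%N & (wt_b k <= 1)%N].
Proof. by rewrite /wt_n /wt_a /wt_b => ko k4; split; lia. Qed.

Lemma weight_decomp_uniq n a b : (a <= 2)%N -> (b <= 1)%N ->
  let k := (12 * n + 4 * a + 6 * b)%N in
  [/\ wt_n k = n, wt_a k = a & wt_b k = b].
Proof.
move=> a2 b1 k.
have kb : wt_b k = b by rewrite /wt_b /k; lia.
by rewrite /wt_n /wt_a kb /k; split; lia.
Qed.

(* [:: B_0; ...; B_(n-1)], by \sum_(i <= m) 'C(m+1, i) B_i = (m == 0). *)
Fixpoint bernoulli_seq (n : nat) : seq rat :=
  if n is m.+1 then
    let s := bernoulli_seq m in
    rcons s (((m == 0%N)%:R - \sum_(i < m) 'C(m.+1, i)%:R * s`_i) / m.+1%:R)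
  else [::].

Definition bernoulli (n : nat) : rat := (bernoulli_seq n.+1)`_n.

Lemma size_bernoulli_seq n : size (bernoulli_seq n) = n.
Proof. by elim: n => //= n IHn; rewrite size_rcons IHn. Qed.

Lemma nth_bernoulli_seq n i : (i < n)%N -> (bernoulli_seq n)`_i = bernoulli i.
Proof.
elim: n => // n IHn; rewrite ltnS leq_eqVlt => /predU1P[-> //|lt_in].
by rewrite /= nth_rcons size_bernoulli_seq lt_in IHn.
Qed.

Lemma bernoulli_sum m :
  \sum_(i < m.+1) 'C(m.+1, i)%:R * bernoulli i = (m == 0%N)%:R.
Proof.
rewrite big_ord_recr /= {2}/bernoulli /= nth_rcons size_bernoulli_seq ltnn eqxx.
rewrite binSn mulrC divfK.
rewrite (eq_bigr (fun i : 'I_m => 'C(m.+1, i)%:R * (bernoulli_seq m)`_i)) => [|i _].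
  by rewrite addrC subrK.
  by rewrite nth_bernoulli_seq.
by rewrite pnatr_eq0.
Qed.

Definition sigma (e n : nat) : nat := (\sum_(d <- divisors n) d ^ e)%N.

Definition eisenstein_coef (k n : nat) : rat :=
  if n == 0%N then 1
  else - ((2 * k)%:R / bernoulli k) * (sigma k.-1 n)%:R.

(* The coefficient of q^m in \sum_(n in Z) q^(n^2) is the number of integers n
   with n^2 = m; these satisfy |n| <= m, so n = i - m with 0 <= i <= 2m. *)
Definition theta_coef (m : nat) : nat :=
  #|[pred i : 'I_(m.*2.+1) | ((i : nat)%:Z - m%:Z) ^+ 2 == m%:Z]|.

Section ModularForms.
Variable R : realType.
Local Notation C := (R[i]).
Local Open Scope complex_scope.

Definition upper_half : set C := [set t | 0 < complex.Im t].

Definition cexp (z : C) : C :=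
  (expR (complex.Re z))%:C * (cos (complex.Im z) +i* sin (complex.Im z)).

Definition nome (t : C) : C := cexp ((2 * pi)%:C * 'i * t).

Definition qseries (a : nat -> C) (t : C) : nat -> C^o :=
  series (fun n => a n * nome t ^+ n : C^o).

Definition has_qexp (f : C -> C) (a : nat -> C) : Prop :=
  forall t, upper_half t -> qseries a t @ \oo --> (f t : C^o).

(* Differentiability over the field C itself, i.e. complex differentiability. *)
Definition holomorphic_on (U : set C) (f : C -> C) : Prop :=
  forall t, U t -> derivable (f : C^o -> C^o) t 1.

(* Only the values on the upper half plane matter; the q-expansion without
   negative powers expresses holomorphy at infinity. *)
Definition modular_form (k : nat) (f : C -> C) : Prop :=
  [/\ holomorphic_on upper_half f,
      forall (g : 'M[int]_2) (t : C), \det g = 1 -> upper_half t ->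
        f (((g 0 0)%:~R * t + (g 0 1)%:~R) / ((g 1 0)%:~R * t + (g 1 1)%:~R))
        = ((g 1 0)%:~R * t + (g 1 1)%:~R) ^+ k * f t
    & exists a, has_qexp f a].

Definition rational_modular_form (k : nat) (f : C -> C) : Prop :=
  modular_form k f /\ exists a : nat -> rat, has_qexp f (fun n => ratr (a n)).

Definition eisenstein (k : nat) (t : C) : C :=
  lim (qseries (fun n => ratr (eisenstein_coef k n)) t @ \oo).

Definition modular_disc (t : C) : C :=
  (eisenstein 4 t ^+ 3 - eisenstein 6 t ^+ 2) / 1728%:R.

Definition jinv (t : C) : C := eisenstein 4 t ^+ 3 / modular_disc t.

(* g = C_k c, for the power series c = \sum_n c_n q^n. *)
Definition is_modular_truncation (k : nat) (c : nat -> C) (g : C -> C) : Prop :=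
  modular_form k g /\
  exists2 a, has_qexp g a & forall n, (n <= wt_n k)%N -> a n = c n.

(* P = P[f].  The defining identity is one of meromorphic functions, so it is
   required at the points where the denominator does not vanish. *)
Definition is_jpoly (k : nat) (f : C -> C) (P : {poly rat}) : Prop :=
  [/\ rational_modular_form k f, (size P <= (wt_n k).+1)%N
    & forall t, upper_half t ->
        let D := modular_disc t ^+ wt_n k * eisenstein 4 t ^+ wt_a k
                 * eisenstein 6 t ^+ wt_b k in
        D != 0 -> f t / D = (map_poly ratr P).[jinv t]].

End ModularForms.

Definition rising (x : rat) (n : nat) : rat := \prod_(i < n) (x + i%:R).

Definition hyp2F1_coef (a b c : rat) (n : nat) : rat :=
  rising a n * rising b n / rising c n / n`!%:R.

(* Polynomial part in j of j^n * \sum_(m >= 0) c_m j^(-m). *)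
Definition poly_part (n : nat) (c : nat -> rat) : {poly rat} :=
  \poly_(i < n.+1) c (n - i)%N.

Definition W0 (n : nat) : {poly rat} := poly_part n (fun m =>
  hyp2F1_coef (- (1 / 24%:R)) (7%:R / 24%:R) (3%:R / 4%:R) m * 1728%:R ^+ m).

Definition W1 (n : nat) : {poly rat} := poly_part n (fun m =>
  hyp2F1_coef (11%:R / 24%:R) (19%:R / 24%:R) (3%:R / 4%:R) m * 1728%:R ^+ m).

Definition W (b n : nat) : {poly rat} := if b == 0%N then W0 n else W1 n.

Definition p_integral (p : nat) (x : rat) : bool := ~~ (p%:Z %| denq x)%Z.

Definition poly_congr (p : nat) (P Q : {poly rat}) : Prop :=
  forall i, [/\ p_integral p P`_i, p_integral p Q`_i
              & (p%:Z %| numq (P`_i - Q`_i))%Z].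

(* Main.v *)
(* With q = s^8, put theta = sum_n q^(n^2), B = sum_(v odd) s^(2v^2) and
   t = sum_(x odd) chi_4(x) x s^(x^2), a multiple of eta(q)^3.  The substitution
   x = u + v, y = u - v in t^2 and in its higher transvectants expresses three
   differential minors of the pair (theta, B) through t, and a cancellation in
   divisor sums (chi_divisor_sum) gives the logarithmic derivatives of t in
   terms of E2, E4, E6.  Together these imply Ramanujan's differential equations
   and the Kaneko-Zagier equation of weight 1/2 for theta,
     192 theta'' - 48 E2 theta' + (E2^2 - E4) theta = 0.
   Modulo p the weight k = (p+1)/2 equals 1/2, so this operator acts on weight k
   forms; on E4^(3(n-m)+a) (E4^3 - E6^2)^m E6^b it acts triangularly, and the
   coefficients of the truncation of theta satisfy modulo p the two-term
   hypergeometric recurrence.  The passage from functions to q-series uses only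
   asymptotic expansions as q -> 0+ along the imaginary axis. *)
From HB Require Import structures.
Require Import Defs.
From mathcomp Require Import all_boot all_order all_algebra.
From mathcomp Require Import ring lra zify complex.
From mathcomp Require Import boolp classical_sets reals topology normedtype.
From mathcomp Require Import sequences exp trigo.

Set Implicit Arguments.
Unset Strict Implicit.
Unset Printing Implicit Defensive.

Import Order.TTheory GRing.Theory Num.Theory.
Import numFieldNormedType.Exports.
Local Open Scope ring_scope.

(** * Formal power series *)

(** All relations between E2, E4, E6 and theta are proved on formal series, without any dimension
    formula for spaces of modular forms. The pair (theta, B) is chosen because both series solve one
    second-order linear equation, whose coefficients are quotients of 2 by 2 differential minors by
    the Wronskian; the Wronskian is t^2, so the quotients are expressible through P = t'/t and P'.
    The divisor sums with even powers up to 6 give E2' and E4'. The next power would bring in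
    sigma_7, that is E8, and the relation E8 = E4^2, usually a dimension count. The third minor is
    used instead: it yields Chazy's third-order equation for E2, from which E6' is read off. For the
    congruence, the operator kills theta, hence sends the truncation to O(q^(n+1)); this is enough
    to determine all the coefficients because the images of the monomials have distinct orders. The
    resulting recurrence can be solved modulo p because 24 n <= p + 1 keeps its denominators prime
    to p. *)

Record fps (R : Type) := Fps { fps_coef :> nat -> R }.

HB.instance Definition _ (R : Type) := gen_eqMixin (fps R).
HB.instance Definition _ (R : Type) := gen_choiceMixin (fps R).

Lemma fpsP (R : Type) (f g : fps R) : (forall n, f n = g n) -> f = g.
Proof. by case: f g => f [g] fg; congr Fps; apply/funext. Qed.

Section FpsRing.
Variable R : comNzRingType.
Implicit Types f g h : fps R.

Definition fps_opp f := Fps (fun n => - f n).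
Definition fps_add f g := Fps (fun n => f n + g n).
(** Sequences are wrapped in the record [fps] so that this product does not compete with the
    pointwise product of functions. *)
Definition fps_mul f g := Fps (fun n => \sum_(i < n.+1) f i * g (n - i)%N).
Definition fps_const (c : R) : fps R := Fps (fun n => if n == 0%N then c else 0).

Fact fps_addA : associative fps_add.
Proof. by move=> f g h; apply: fpsP => n /=; rewrite addrA. Qed.
Fact fps_addC : commutative fps_add.
Proof. by move=> f g; apply: fpsP => n /=; rewrite addrC. Qed.
Fact fps_add0 : left_id (fps_const 0) fps_add.
Proof. by move=> f; apply: fpsP => n /=; rewrite if_same add0r. Qed.
Fact fps_addN : left_inverse (fps_const 0) fps_opp fps_add.
Proof. by move=> f; apply: fpsP => n /=; rewrite if_same addNr. Qed.

HB.instance Definition _ :=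
  GRing.isZmodule.Build (fps R) fps_addA fps_addC fps_add0 fps_addN.

(** The ring laws of the product are inherited from polynomials: coefficient n of a product depends
    only on the truncations below n + 1. *)
Definition fps_trunc (N : nat) f : {poly R} := \poly_(i < N) f i.

Lemma coef_trunc N f i : (i < N)%N -> (fps_trunc N f)`_i = f i.
Proof. by move=> iN; rewrite coef_poly iN. Qed.

Lemma coef_trunc_mul N f g i : (i < N)%N ->
  (fps_trunc N f * fps_trunc N g)`_i = fps_mul f g i.
Proof.
move=> iN; rewrite coefM; apply: eq_bigr => j _.
by rewrite !coef_trunc// (leq_ltn_trans _ iN) ?leq_subr// -ltnS.
Qed.

Fact fps_mulC : commutative fps_mul.
Proof.
by move=> f g; apply: fpsP => n; rewrite -!(@coef_trunc_mul n.+1)// mulrC.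
Qed.

Fact fps_mulA : associative fps_mul.
Proof.
move=> f g h; apply: fpsP => n.
have eT f1 f2 : forall i, (i <= n)%N ->
    (fps_trunc n.+1 (fps_mul f1 f2))`_i = (fps_trunc n.+1 f1 * fps_trunc n.+1 f2)`_i.
  by move=> i ni; rewrite coef_trunc// coef_trunc_mul.
rewrite -!(@coef_trunc_mul n.+1)// [LHS]coefM [RHS]coefM.
under eq_bigr do rewrite eT ?leq_subr//.
under [RHS]eq_bigr => i _ do rewrite eT -1?ltnS//.
by rewrite -!coefM mulrA.
Qed.

Fact fps_mul1 : left_id (fps_const 1) fps_mul.
Proof.
move=> f; apply: fpsP => n /=; rewrite big_ord_recl /= mul1r subn0 big1 ?addr0//.
by move=> i _; rewrite mul0r.
Qed.

Fact fps_mulD : left_distributive fps_mul fps_add.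
Proof.
move=> f g h; apply: fpsP => n /=; rewrite -big_split; apply: eq_bigr => i _.
by rewrite mulrDl.
Qed.

Fact fps_1_neq0 : fps_const 1 != 0.
Proof.
apply/eqP => /(congr1 (fun f : fps R => f 0%N)) /=.
by move/eqP; rewrite oner_eq0.
Qed.

HB.instance Definition _ := GRing.Zmodule_isComNzRing.Build (fps R)
  fps_mulA fps_mulC fps_mul1 fps_mulD fps_1_neq0.

Lemma fpsE0 n : (0 : fps R) n = 0.
Proof. by rewrite /= if_same. Qed.

Lemma fpsE1 n : (1 : fps R) n = (n == 0%N)%:R.
Proof. by rewrite /=; case: eqP. Qed.

Lemma fpsEadd f g n : (f + g) n = f n + g n. Proof. by []. Qed.
Lemma fpsEopp f n : (- f) n = - f n. Proof. by []. Qed.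
Lemma fpsEsub f g n : (f - g) n = f n - g n. Proof. by []. Qed.

Lemma fpsEmul f g n : (f * g) n = \sum_(i < n.+1) f i * g (n - i)%N.
Proof. by []. Qed.

Lemma fpsEsum I (r : seq I) (P : pred I) (F : I -> fps R) n :
  (\sum_(i <- r | P i) F i) n = \sum_(i <- r | P i) F i n.
Proof.
apply: (big_morph (fun f : fps R => f n)) => //; exact: fpsE0.
Qed.

Fact fps_const_is_zmod : zmod_morphism fps_const.
Proof.
move=> a b; apply: fpsP => n; rewrite fpsEsub /=.
by case: eqP => // _; rewrite subr0.
Qed.

Fact fps_const_is_monoid : monoid_morphism fps_const.
Proof.
split=> // a b; apply: fpsP => n; rewrite fpsEmul big_ord_recl /= subn0 big1.
  by rewrite addr0; case: eqP => // _; rewrite mulr0.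
by move=> i _; rewrite mul0r.
Qed.

HB.instance Definition _ :=
  GRing.isZmodMorphism.Build R (fps R) fps_const fps_const_is_zmod.
HB.instance Definition _ :=
  GRing.isMonoidMorphism.Build R (fps R) fps_const fps_const_is_monoid.

Lemma fpsEconst c f n : (fps_const c * f) n = c * f n.
Proof.
rewrite fpsEmul big_ord_recl /= subn0 big1 ?addr0// => i _.
by rewrite mul0r.
Qed.

Lemma fpsEnat m f n : (m%:R * f) n = m%:R * f n.
Proof. by rewrite -[m%:R in LHS](rmorph_nat fps_const) fpsEconst. Qed.

Lemma fpsEnat1 m n : (m%:R : fps R) n = if n == 0%N then m%:R else 0.
Proof. by rewrite -(rmorph_nat fps_const). Qed.

(** The Euler operator q d/dq, which preserves the order of a series. *)
Definition fpsD f : fps R := Fps (fun n => n%:R * f n).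

Lemma fpsEderiv f n : fpsD f n = n%:R * f n. Proof. by []. Qed.

Fact fpsD_is_zmod : zmod_morphism fpsD.
Proof. by move=> f g; apply: fpsP => n; rewrite /= mulrBr. Qed.

HB.instance Definition _ :=
  GRing.isZmodMorphism.Build (fps R) (fps R) fpsD fpsD_is_zmod.

Lemma fpsDM f g : fpsD (f * g) = fpsD f * g + f * fpsD g.
Proof.
apply: fpsP => n; rewrite fpsEadd fpsEderiv !fpsEmul mulr_sumr -big_split /=.
apply: eq_bigr => i _.
have {1}-> : n = (i + (n - i))%N by rewrite subnKC // -ltnS.
by rewrite natrD; ring.
Qed.

Lemma fpsD_const c : fpsD (fps_const c) = 0.
Proof.
by apply: fpsP => n; rewrite fpsE0 /=; case: n => [|n]; rewrite ?mul0r//= mulr0.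
Qed.

Lemma fpsD_nat m : fpsD m%:R = 0.
Proof. by rewrite -(rmorph_nat fps_const) fpsD_const. Qed.

Lemma fpsD_constM c f : fpsD (fps_const c * f) = fps_const c * fpsD f.
Proof. by rewrite fpsDM fpsD_const mul0r add0r. Qed.

Lemma fpsD_natM m f : fpsD (m%:R * f) = m%:R * fpsD f.
Proof. by rewrite fpsDM fpsD_nat mul0r add0r. Qed.

(** Multiplication by f avoids the exponent n - 1, so that n = 0 is not an exception. *)
Lemma fpsDX f n : f * fpsD (f ^+ n) = n%:R * f ^+ n * fpsD f.
Proof.
elim: n => [|n IH]; first by rewrite expr0 (fpsD_nat 1) !mul0r mulr0.
by rewrite exprS fpsDM mulrDr IH -natr1; ring.
Qed.

Definition fps_eqmod (N : nat) f g := forall n, (n <= N)%N -> f n = g n.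

Lemma fps_eqmodM N f f' g g' :
  fps_eqmod N f f' -> fps_eqmod N g g' -> fps_eqmod N (f * g) (f' * g').
Proof.
move=> ff gg n nN; rewrite !fpsEmul; apply: eq_bigr => i _.
have iN : (i <= N)%N by rewrite (leq_trans _ nN)// -ltnS.
by rewrite ff// gg// (leq_trans (leq_subr _ _)).
Qed.

Definition fps_ord (m : nat) f := forall n, (n < m)%N -> f n = 0.

Lemma fps_ordM m1 m2 f g : fps_ord m1 f -> fps_ord m2 g ->
  fps_ord (m1 + m2) (f * g) /\ (f * g) (m1 + m2)%N = f m1 * g m2.
Proof.
move=> fm gm; split=> [n nm|].
  rewrite fpsEmul big1// => i _; have [im|mi] := ltnP i m1.
    by rewrite fm// mul0r.
  rewrite gm ?mulr0// ltn_subLR ?(leq_trans nm) ?leq_add2r //.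
  by rewrite -ltnS.
have lt1 : (m1 < (m1 + m2).+1)%N by rewrite ltnS leq_addr.
rewrite fpsEmul (bigD1 (Ordinal lt1))//= addKn big1 ?addr0// => i ni.
have [im|mi] := ltnP i m1; first by rewrite fm// mul0r.
rewrite gm ?mulr0// -(ltn_add2l i) subnKC; last by rewrite -ltnS.
by rewrite ltn_add2r ltn_neqAle mi andbT eq_sym.
Qed.

Lemma fps_ordX m f k : fps_ord m f ->
  fps_ord (m * k) (f ^+ k) /\ (f ^+ k) (m * k)%N = f m ^+ k.
Proof.
move=> fm; elim: k => [|k [IH1 IH2]].
  by rewrite muln0 !expr0; split => // n; rewrite ltn0.
by rewrite mulnS !exprS -IH2; apply: fps_ordM.
Qed.

Lemma fps_ord0 f : fps_ord 0 f. Proof. by []. Qed.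

End FpsRing.

Arguments fpsD {R} f.

Lemma fps_mulf_eq0 (R : idomainType) (f g : fps R) : f * g = 0 -> f != 0 -> g = 0.
Proof.
move=> fg0 fn0.
have ex (h : fps R) : h != 0 -> exists2 m, fps_ord m h & h m != 0.
  move=> hn0; have hex : exists m, h m != 0.
    apply: contrapT => /forallNP hm; case/eqP: hn0; apply: fpsP => n.
    by rewrite fpsE0; have /negP := hm n; rewrite negbK => /eqP.
  exists (ex_minn hex); case: ex_minnP => // m _ mmin n nm.
  by apply/eqP; apply: contraTT nm => hn; rewrite -leqNgt mmin.
have [//|/ex[m2 g2 gm]] := eqVneq g 0; have [m1 f1 fm] := ex f fn0.
have [_] := fps_ordM f1 g2; rewrite fg0 fpsE0 => /esym/eqP.
by rewrite mulf_eq0 (negPf fm) (negPf gm).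
Qed.

Lemma fps_mulfI (R : idomainType) (f : fps R) : f != 0 -> injective ( *%R f).
Proof.
move=> fn0 g h /= fgh; apply/eqP; rewrite -subr_eq0; apply/eqP.
by apply: (@fps_mulf_eq0 _ f) => //; rewrite mulrBr fgh subrr.
Qed.

Lemma fps_nat_neq0 (R : numDomainType) n : (n != 0)%N -> (n%:R : fps R) != 0.
Proof.
move=> n0; apply/eqP => /(congr1 (fun f : fps R => f 0%N)).
by rewrite fpsEnat1 fpsE0 /= => /eqP; rewrite pnatr_eq0 (negPf n0).
Qed.

Section FpsMap.
Variables (R S : comNzRingType) (phi : {rmorphism R -> S}).

Definition fps_map (f : fps R) : fps S := Fps (fun n => phi (f n)).

Fact fps_map_is_zmod : zmod_morphism fps_map.
Proof. by move=> f g; apply: fpsP => n; rewrite /= rmorphB. Qed.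

Fact fps_map_is_monoid : monoid_morphism fps_map.
Proof.
split=> [|f g]; apply: fpsP => n.
  by rewrite fpsE1 /=; case: eqP; rewrite ?rmorph1 ?rmorph0.
by rewrite fpsEmul /= rmorph_sum; apply: eq_bigr => i _; rewrite rmorphM.
Qed.

HB.instance Definition _ :=
  GRing.isZmodMorphism.Build (fps R) (fps S) fps_map fps_map_is_zmod.
HB.instance Definition _ :=
  GRing.isMonoidMorphism.Build (fps R) (fps S) fps_map fps_map_is_monoid.

Lemma fpsEmap f n : fps_map f n = phi (f n). Proof. by []. Qed.

Lemma fpsD_map f : fpsD (fps_map f) = fps_map (fpsD f).
Proof. by apply: fpsP => n; rewrite /= rmorphM rmorph_nat. Qed.

End FpsMap.

Section FpsExpand.
Variables (R : comNzRingType) (d : nat).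
Hypothesis d_gt0 : (0 < d)%N.

(** The substitution q = s^d. It is injective and commutes with the Euler operator up to the factor
    d, so identities proved in s descend to q. *)
Definition fps_expand (f : fps R) : fps R :=
  Fps (fun n => if (d %| n)%N then f (n %/ d)%N else 0).

Lemma fpsEexpand f n :
  fps_expand f n = if (d %| n)%N then f (n %/ d)%N else 0.
Proof. by []. Qed.

Fact fps_expand_is_zmod : zmod_morphism fps_expand.
Proof.
by move=> f g; apply: fpsP => n; rewrite /=; case: ifP; rewrite // subr0.
Qed.

Fact fps_expandM (f g : fps R) : fps_expand (f * g) = fps_expand f * fps_expand g.
Proof.
apply: fpsP => n; rewrite fpsEmul fpsEexpand; have [dn|dn] := boolP (d %| n)%N; last first.
  rewrite big1// => i _ /=; case: ifP => di; last by rewrite mul0r.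
  case: ifP => dni; last by rewrite mulr0.
  have ni : (i <= n)%N by rewrite -ltnS.
  by rewrite -(subnKC ni) dvdn_add in dn.
pose h (i : 'I_(n %/ d).+1) : 'I_n.+1 := inord (i * d).
have hE i : h i = (i * d)%N :> nat.
  rewrite inordK// ltnS -{2}(divnK dn) leq_mul2r.
  by rewrite -[(i <= _)%N]ltnS ltn_ord orbT.
rewrite fpsEmul (bigID (fun i : 'I_n.+1 => d %| i)%N) /= [X in _ = _ + X]big1 ?addr0.
  rewrite (reindex_onto h (fun i => inord (i %/ d))) /=.
    apply: eq_big => i.
      by rewrite hE dvdn_mull// mulnK// inord_val eqxx.
    have nE : (n - i * d = (n %/ d - i) * d)%N by rewrite mulnBl divnK.
    by move=> _; rewrite hE nE !dvdn_mull// !mulnK.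
  move=> i di; apply/val_inj; rewrite /= hE inordK ?divnK//.
  by rewrite ltnS leq_div2r// -ltnS.
by move=> i /negPf->; rewrite mul0r.
Qed.

Fact fps_expand_is_monoid : monoid_morphism fps_expand.
Proof.
split; last exact: fps_expandM.
apply: fpsP => -[|n]; rewrite /= ?dvdn0 ?div0n//.
by case: ifP => // dn; rewrite gtn_eqF// divn_gt0// dvdn_leq.
Qed.

Lemma fpsD_expand (f : fps R) :
  fpsD (fps_expand f) = d%:R * fps_expand (fpsD f).
Proof.
apply: fpsP => n; rewrite fpsEnat fpsEderiv !fpsEexpand.
case: ifP => dn; last by rewrite !mulr0.
by rewrite fpsEderiv -{1}(divnK dn) mulnC natrM mulrA.
Qed.

Lemma fps_expand_inj : injective fps_expand.
Proof.
move=> f g /(congr1 (fun h : fps R => h (_ * d)%N)) fg; apply: fpsP => n.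
by have := fg n; rewrite !fpsEexpand dvdn_mull// mulnK.
Qed.

End FpsExpand.

(** * Theta series and their differential minors *)

(** Lattice sums run over filtered lists of integer tuples; [h] and [h'] need to be inverse to each
    other on the filtered parts only. *)
Lemma reindex_seq (V : nmodType) (I J : eqType) (L1 : seq I) (L2 : seq J)
    (P1 : pred I) (P2 : pred J) (h : I -> J) (h' : J -> I) (F : J -> V) :
  uniq L1 -> uniq L2 ->
  (forall z, z \in L1 -> P1 z -> [/\ h z \in L2, P2 (h z) & h' (h z) = z]) ->
  (forall w, w \in L2 -> P2 w -> [/\ h' w \in L1, P1 (h' w) & h (h' w) = w]) ->
  \sum_(w <- L2 | P2 w) F w = \sum_(z <- L1 | P1 z) F (h z).
Proof.
move=> u1 u2 H1 H2; rewrite -big_filter -[RHS]big_filter -(big_map h predT).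
apply: perm_big; apply: uniq_perm; first exact: filter_uniq.
  rewrite map_inj_in_uniq ?filter_uniq// => x y; rewrite !mem_filter.
  move=> /andP[Px xL] /andP[Py yL] hxy.
  by have [_ _ <-] := H1 x xL Px; have [_ _ <-] := H1 y yL Py; rewrite hxy.
move=> w; apply/idP/mapP => [|[z + ->]]; rewrite !mem_filter.
  move=> /andP[Pw wL]; have [L P <-] := H2 w wL Pw.
  by exists (h' w); rewrite ?mem_filter ?P.
by move=> /andP[Pz zL]; have [-> -> _] := H1 z zL Pz.
Qed.

(** The sum equals its own opposite. Fixed points are harmless, since [int] has no 2-torsion. *)
Lemma sum_involution (I : eqType) (L : seq I) (P : pred I) (s : I -> I)
    (F : I -> int) : uniq L ->
  (forall z, z \in L -> P z -> [/\ s z \in L, P (s z), s (s z) = z & F (s z) = - F z]) ->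
  \sum_(z <- L | P z) F z = 0.
Proof.
move=> uL H; suff: \sum_(z <- L | P z) F z = - \sum_(z <- L | P z) F z by lia.
rewrite -sumrN (@reindex_seq _ _ _ L L P P s s)//.
- rewrite big_seq_cond [RHS]big_seq_cond; apply: eq_bigr => z /andP[zL Pz].
  by have [_ _ _ ->] := H z zL Pz.
- by move=> z zL Pz; have [? ? ? _] := H z zL Pz.
- by move=> z zL Pz; have [? ? ? _] := H z zL Pz.
Qed.

(* Locked to prevent simplification from enumerating the range. *)
Definition zrange (K : nat) : seq int :=
  locked [seq i%:Z - K%:Z | i <- iota 0 K.*2.+1].

Lemma mem_zrange K x : (x \in zrange K) = (`|x| <= K%:Z).
Proof.
rewrite /zrange -lock; apply/mapP/idP => [[i + ->]|xK]; first by rewrite mem_iota; lia.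
by exists (absz (x + K%:Z)); rewrite ?mem_iota; lia.
Qed.

Lemma uniq_zrange K : uniq (zrange K).
Proof. by rewrite /zrange -lock map_inj_uniq ?iota_uniq// => i j; lia. Qed.

Definition zbox2 K : seq (int * int) := [seq (x, y) | x <- zrange K, y <- zrange K].
Definition zbox3 K : seq (int * int * int) :=
  [seq (z, y) | z <- zbox2 K, y <- zrange K].

Lemma mem_zbox2 K x y : ((x, y) \in zbox2 K) = (x \in zrange K) && (y \in zrange K).
Proof.
apply/allpairsP/andP => [[[a b] /= [aK bK [-> ->]]]//|[xK yK]].
by exists (x, y).
Qed.

Lemma mem_zbox3 K x y z : ((x, y, z) \in zbox3 K) =
  [&& x \in zrange K, y \in zrange K & z \in zrange K].
Proof.
apply/allpairsP/and3P => [[[[a b] c] /=]|[xK yK zK]].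
  by rewrite mem_zbox2 => -[/andP[aK bK] cK [-> -> ->]].
by exists (x, y, z); rewrite mem_zbox2 xK yK zK.
Qed.

Lemma uniq_zbox2 K : uniq (zbox2 K).
Proof. by apply: allpairs_uniq; rewrite ?uniq_zrange// => -[a b] [c d]. Qed.

Lemma uniq_zbox3 K : uniq (zbox3 K).
Proof.
by apply: allpairs_uniq; rewrite ?uniq_zbox2 ?uniq_zrange// => -[a b] [c d].
Qed.

Lemma sum_zbox2 (V : nmodType) K (P : int -> int -> bool) (F : int -> int -> V) :
  \sum_(z <- zbox2 K | P z.1 z.2) F z.1 z.2 =
  \sum_(x <- zrange K) \sum_(y <- zrange K | P x y) F x y.
Proof.
rewrite big_mkcond /zbox2 big_allpairs_dep /=.
by apply: eq_bigr => x _; rewrite [RHS]big_mkcond.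
Qed.

(** Agreement is asked up to degree N only, so that one finite box can serve all the factors of a
    product. *)
Definition indexed_by (I : eqType) (L : seq I) (w : I -> int) (c : I -> int)
  (N : nat) (f : fps int) :=
  forall i, (i <= N)%N -> f i = \sum_(x <- L | w x == i%:Z) c x.

Lemma indexed_byM (I J : eqType) (L1 : seq I) (L2 : seq J) w1 w2 c d N f g :
  (forall x, x \in L1 -> 0 <= w1 x) -> (forall y, y \in L2 -> 0 <= w2 y) ->
  indexed_by L1 w1 c N f -> indexed_by L2 w2 d N g ->
  (f * g) N = \sum_(x <- L1) \sum_(y <- L2 | w1 x + w2 y == N%:Z) c x * d y.
Proof.
move=> w1p w2p fE gE; rewrite fpsEmul.
transitivity (\sum_(i < N.+1) \sum_(x <- L1) \sum_(y <- L2)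
    (if (w1 x == i%:Z) && (w2 y == (N - i)%N%:Z) then c x * d y else 0)).
  apply: eq_bigr => i _; rewrite fE ?gE ?leq_subr//; last by rewrite -ltnS.
  rewrite big_distrlr /= big_mkcond; apply: eq_bigr => x _.
  case: ifP => _ /=; last by rewrite big1.
  by rewrite [LHS]big_mkcond.
rewrite exchange_big /= big_seq [RHS]big_seq; apply: eq_bigr => x xL.
rewrite exchange_big /= [RHS]big_mkcond big_seq [RHS]big_seq; apply: eq_bigr => y yL.
have := w1p x xL; have := w2p y yL => wy wx.
case: ifP => [/eqP wN|wN]; last first.
  by rewrite big1// => i _; rewrite ifF//; have := ltn_ord i; lia.
have iN : (absz (w1 x) < N.+1)%N by lia.
rewrite (bigD1 (Ordinal iN))//= ifT; last by lia.
rewrite big1 ?addr0// => i /eqP ni; rewrite ifF//; apply/negP => /andP[/eqP wi _].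
by apply: ni; apply/val_inj => /=; lia.
Qed.

(** The series sum_x c(x) s^(w x). The range |x| <= N contains every solution of w x = N as soon as
    |x| <= w x, the condition carried by the lemmas below. *)
Definition tser (w c : int -> int) : fps int :=
  Fps (fun N => \sum_(x <- zrange N | w x == N%:Z) c x).

Lemma tser_indexed w c N K : (forall x, `|x| <= w x) -> (N <= K)%N ->
  indexed_by (zrange K) w c N (tser w c).
Proof.
move=> wx NK i iN /=.
apply: (@reindex_seq _ _ _ _ _ _ _ id id) => //; rewrite ?uniq_zrange// => z.
  by rewrite !mem_zrange => _ wi; split=> //; have := wx z; lia.
by rewrite !mem_zrange => zi wi; split=> //; lia.
Qed.

Lemma tserM w1 w2 c d N K : (forall x, `|x| <= w1 x) -> (forall x, `|x| <= w2 x) ->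
  (N <= K)%N -> (tser w1 c * tser w2 d) N =
  \sum_(z <- zbox2 K | w1 z.1 + w2 z.2 == N%:Z) c z.1 * d z.2.
Proof.
move=> wx1 wx2 NK.
rewrite (sum_zbox2 _ (fun x y => w1 x + w2 y == N) (fun x y => c x * d y)).
apply: indexed_byM; [| |exact: tser_indexed..].
- by move=> x _; apply: le_trans (wx1 x).
- by move=> x _; apply: le_trans (wx2 x).
Qed.

Lemma fpsD_tser w c : fpsD (tser w c) = tser w (fun x => w x * c x).
Proof.
apply: fpsP => N; rewrite fpsEderiv /= mulr_sumr; apply: eq_bigr => x /eqP->.
by rewrite natz.
Qed.

Lemma eq_tser w c d : c =1 d -> tser w c = tser w d.
Proof. by move=> cd; apply: fpsP => N; apply: eq_bigr => x _. Qed.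

Definition chi (x : int) : int :=
  if (x %% 4)%Z == 1 then 1 else if (x %% 4)%Z == 3 then -1 else 0.

Lemma chiN x : chi (- x) = - chi x.
Proof. by rewrite /chi; do !case: eqP; lia. Qed.

Lemma chi_even x : (x %% 2)%Z = 0 -> chi x = 0.
Proof. by rewrite /chi; do !case: eqP; lia. Qed.

Lemma chi_pair u v : (u %% 2)%Z = 0 -> (v %% 2)%Z = 1 ->
  chi (u + v) * chi (u - v) = -1.
Proof. by rewrite /chi; do !case: eqP; lia. Qed.

(* The substitution x = u + v, y = u - v.  Exchanging u and v identifies the
   terms with u odd, v even with those with u even, v odd. *)
Lemma chi_rotate N K (G : int -> int -> int) :
  (N <= K)%N -> (forall x y, G x (- y) = - G x y) ->
  \sum_(z <- zbox2 K | z.1 ^+ 2 + z.2 ^+ 2 == N%:Z) chi z.1 * chi z.2 * G z.1 z.2 =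
  - 2 * \sum_(z <- zbox2 K | 2 * z.1 ^+ 2 + 2 * z.2 ^+ 2 == N%:Z)
    ((z.1 %% 2)%Z == 0)%:R * ((z.2 %% 2)%Z == 1)%:R * G (z.1 + z.2) (z.1 - z.2).
Proof.
move=> NK Godd; pose cond (z : int * int) := 2 * z.1 ^+ 2 + 2 * z.2 ^+ 2 == N%:Z.
pose F (z : int * int) := chi z.1 * chi z.2 * G z.1 z.2.
pose h (z : int * int) := (z.1 + z.2, z.1 - z.2).
transitivity (\sum_(z <- zbox2 K | cond z && ((z.1 + z.2) %% 2 == 1)%Z) F (h z)).
  rewrite (bigID (fun z : int * int => ((z.1 %% 2 == 1) && (z.2 %% 2 == 1))%Z)) /=.
  rewrite [X in _ + X]big1 ?addr0; last first.
    move=> [x y] /= /andP[_]; rewrite negb_and => /orP[] xy.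
      by rewrite chi_even ?mul0r//; lia.
    by rewrite [chi y]chi_even ?mulr0 ?mul0r//; lia.
  apply: (@reindex_seq _ _ _ _ _ _ _ h
    (fun z => (((z.1 + z.2) %/ 2)%Z, ((z.1 - z.2) %/ 2)%Z))); rewrite ?uniq_zbox2//.
    move=> [u v]; rewrite /cond /h /= !mem_zbox2 !mem_zrange => /andP[uK vK].
    move=> /andP[/eqP uvN odd]; split; first by apply/andP; split; nia.
      by apply/andP; split; [apply/eqP; rewrite -uvN; ring | lia].
    by congr pair; lia.
  move=> [x y]; rewrite /cond /h /= !mem_zbox2 !mem_zrange => /andP[xK yK].
  move=> /andP[/eqP xyN odd]; split; first by apply/andP; split; lia.
    apply/andP; split; last by lia.
    move: xyN; have [a [b [-> ->]]] : exists a b, x = a + b /\ y = a - b.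
      by exists ((x + y) %/ 2)%Z, ((x - y) %/ 2)%Z; lia.
    have -> : ((a + b + (a - b)) %/ 2)%Z = a by lia.
    have -> : ((a + b - (a - b)) %/ 2)%Z = b by lia.
    by move=> <-; apply/eqP; ring.
  by congr pair; lia.
(* Exchanging u and v changes the sign of both chi(u - v) and G, so the two halves are equal; this
   is the factor 2. *)
rewrite (bigID (fun z : int * int => (z.1 %% 2 == 0)%Z)) /=.
rewrite [X in _ + X](@reindex_seq _ _ _ (zbox2 K) _
  (fun z => (cond z && ((z.1 + z.2) %% 2 == 1)%Z) && (z.1 %% 2 == 0)%Z) _
  (fun z => (z.2, z.1)) (fun z => (z.2, z.1))); rewrite ?uniq_zbox2//; first last.
- move=> [x y]; rewrite /cond /= !mem_zbox2 andbC => -> /andP[/andP[/eqP xyN ?] ?].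
  by split=> //; apply/andP; split; [apply/andP; split; [apply/eqP|]|]; lia.
- move=> [x y]; rewrite /cond /= !mem_zbox2 andbC => -> /andP[/andP[/eqP xyN ?] ?].
  by split=> //; apply/andP; split; [apply/andP; split; [apply/eqP|]|]; lia.
rewrite -big_split /= mulr_sumr.
rewrite big_mkcond [RHS]big_mkcond; apply: eq_bigr => -[u v] _.
rewrite /cond /F /=; case: eqP => //= uvN.
have [ue|ue] := eqVneq ((u %% 2)%Z) 0; last first.
  by rewrite andbF !mul0r mulr0.
rewrite andbT; case: eqP => odd; last first.
  by rewrite [_ == 1](_ : _ = false) ?mulr0 ?mul0r ?mulr0//; lia.
have vo : (v %% 2)%Z = 1 by lia.
rewrite vo eqxx.
have -> : v - u = - (u - v) by lia.
have := chi_pair ue vo; rewrite chiN (addrC v u) Godd.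
set c1 := chi (u + v); set c2 := chi (u - v); set g := G _ _ => c12.
transitivity (2 * (c1 * c2) * g); first by ring.
by rewrite c12 (_ : true%:R = 1)//; ring.
Qed.

(* In the variable s = q^(1/8), eta_ser 1 is 2 eta(q)^3, theta_even is
   sum_n q^(n^2) and theta_odd is sum_n q^((n+1/2)^2). *)
Definition norm1 (x : int) : int := x ^+ 2.
Definition norm2 (x : int) : int := 2 * x ^+ 2.

Lemma norm1_ge x : `|x| <= norm1 x. Proof. by rewrite /norm1; nia. Qed.
Lemma norm2_ge x : `|x| <= norm2 x. Proof. by rewrite /norm2; nia. Qed.

Definition eta_ser (j : nat) := tser norm1 (fun x => chi x * x ^+ j).
Definition theta_even := tser norm2 (fun u => ((u %% 2)%Z == 0)%:R).
Definition theta_odd := tser norm2 (fun v => ((v %% 2)%Z == 1)%:R).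

Lemma fpsD_eta_ser j : fpsD (eta_ser j) = eta_ser j.+2.
Proof.
by rewrite fpsD_tser; apply: eq_tser => x; rewrite /norm1 !exprS; ring.
Qed.

Local Notation D := fpsD.

(** Rotation of G = xy: it becomes u^2 - v^2, half the difference of the exponents of the two theta
    series. *)
Lemma wronskian_eta : eta_ser 1 ^+ 2 =
  theta_even * D theta_odd - D theta_even * theta_odd.
Proof.
apply: fpsP => N; rewrite expr2 fpsEsub !fpsD_tser.
rewrite !(@tserM _ _ _ _ _ _ norm1_ge norm1_ge (leqnn N)).
rewrite !(@tserM _ _ _ _ _ _ norm2_ge norm2_ge (leqnn N)).
under eq_bigr do rewrite !expr1 mulrACA.
rewrite (@chi_rotate N N (fun x y => x * y))// => [|x y]; last by rewrite mulrN.
rewrite mulr_sumr -sumrB; apply: eq_bigr => -[u v] /= _.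
by rewrite /norm2; ring.
Qed.

(** Rotation of xy (x^2 - y^2)^2: since x^2 - y^2 = 4uv, the new factor 16 u^2 v^2 puts one more
    derivative on each theta series of the Wronskian. *)
Lemma transvectant2_eta :
  eta_ser 1 * eta_ser 5 - eta_ser 3 ^+ 2 =
  2 * (D theta_even * D (D theta_odd) - D (D theta_even) * D theta_odd).
Proof.
(* Doubling allows the left side to be written symmetrically in x and y. *)
apply: (@fps_mulfI _ 2); first exact: fps_nat_neq0.
rewrite [LHS](_ : _ = eta_ser 1 * eta_ser 5 + eta_ser 5 * eta_ser 1
  - 2 * (eta_ser 3 * eta_ser 3)); last by ring.
apply: fpsP => N; rewrite fpsEsub fpsEadd !fpsEnat fpsEsub !fpsD_tser.
rewrite !(@tserM _ _ _ _ _ _ norm1_ge norm1_ge (leqnn N)).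
rewrite !(@tserM _ _ _ _ _ _ norm2_ge norm2_ge (leqnn N)).
rewrite !mulr_sumr -!big_split -sumrB -sumrB !mulr_sumr.
transitivity (\sum_(z <- zbox2 N | z.1 ^+ 2 + z.2 ^+ 2 == N%:Z)
  chi z.1 * chi z.2 * (z.1 * z.2 * (z.1 ^+ 2 - z.2 ^+ 2) ^+ 2)).
  by apply: eq_bigr => z _ /=; ring.
rewrite (@chi_rotate N N (fun x y => x * y * (x ^+ 2 - y ^+ 2) ^+ 2))//.
  by rewrite mulr_sumr; apply: eq_bigr => -[u v] /= _; rewrite /norm2; ring.
by move=> x y; ring.
Qed.

(** The same with (x^2 - y^2)^4 = 256 u^4 v^4, which gives two more derivatives on each factor. *)
Lemma transvectant4_eta :
  eta_ser 1 * eta_ser 9 - 4 * (eta_ser 3 * eta_ser 7) + 3 * eta_ser 5 ^+ 2 =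
  8 * (D (D theta_even) * D (D (D theta_odd))
       - D (D (D theta_even)) * D (D theta_odd)).
Proof.
apply: (@fps_mulfI _ 2); first exact: fps_nat_neq0.
rewrite [LHS](_ : _ = eta_ser 1 * eta_ser 9 + eta_ser 9 * eta_ser 1
  + 6 * (eta_ser 5 * eta_ser 5)
  - (4 * (eta_ser 3 * eta_ser 7) + 4 * (eta_ser 7 * eta_ser 3))); last by ring.
apply: fpsP => N; rewrite fpsEsub !fpsEadd !fpsEnat fpsEsub !fpsD_tser.
rewrite !(@tserM _ _ _ _ _ _ norm1_ge norm1_ge (leqnn N)).
rewrite !(@tserM _ _ _ _ _ _ norm2_ge norm2_ge (leqnn N)).
rewrite !mulr_sumr -!big_split -!sumrB !mulr_sumr.
transitivity (\sum_(z <- zbox2 N | z.1 ^+ 2 + z.2 ^+ 2 == N%:Z)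
  chi z.1 * chi z.2 * (z.1 * z.2 * (z.1 ^+ 2 - z.2 ^+ 2) ^+ 4)).
  by apply: eq_bigr => z _ /=; ring.
rewrite (@chi_rotate N N (fun x y => x * y * (x ^+ 2 - y ^+ 2) ^+ 4))//.
  by rewrite mulr_sumr; apply: eq_bigr => -[u v] /= _; rewrite /norm2; ring.
by move=> x y; ring.
Qed.

(** * Divisor sums *)

Lemma chi_shift x r : chi (x + 2 * r) = if (r %% 2)%Z == 0 then chi x else - chi x.
Proof. by rewrite /chi; do !case: eqP; lia. Qed.

(* The sum over X^2 + 8rn = N, in the variables Y = X - 2r and e = r + 2n + Y
   for which 4re = N - Y^2.  Involutions cancel all terms except those with
   e - r = -Y or e = 0, and these force N to be a square. *)
Lemma chi_divisor_sum (phi : int -> int) (N K : nat) :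
  (forall x, phi (- x) = phi x) -> (6 * N + 6 <= K)%N ->
  \sum_(z <- zbox3 K | [&& 0 < z.1.2, 0 < z.2 & z.1.1 ^+ 2 + 8 * z.1.2 * z.2 == N%:Z])
     chi z.1.1 * phi (z.1.1 - 2 * z.1.2) =
  \sum_(z <- [seq (x, i) | x <- zrange N, i <- iota 0 K] |
     [&& 0 < z.1, (z.1 %% 2)%Z == 1, z.1 ^+ 2 == N%:Z & 2 * z.2%:Z + 1 < z.1])
     chi z.1 * (phi z.1 - phi (2 * z.2%:Z + 1)).
Proof.
move=> phiN NK.
set L := [seq (x, i) | x <- zrange N, i <- iota 0 K].
have memL x i : ((x, i) \in L) = (`|x| <= N%:Z) && (i < K)%N.
  apply/allpairsP/andP => [[[a b] /= [aK + [-> ->]]]|[xN iK]].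
    by rewrite mem_iota mem_zrange in aK *; rewrite add0n.
  by exists (x, i); rewrite mem_zrange mem_iota.
have uL : uniq L.
  by apply: allpairs_uniq; rewrite ?uniq_zrange ?iota_uniq// => -[a b] [c d].
move: L memL uL => L memL uL.
pose cond (z : int * int * int) := [&& (z.1.1 %% 2)%Z == 1, 0 < z.1.2,
  z.1.1 < z.2 - z.1.2, ((z.2 - z.1.2) %% 2)%Z == 1
  & 4 * z.1.2 * z.2 == N%:Z - z.1.1 ^+ 2].
pose F (z : int * int * int) := chi (z.1.1 + 2 * z.1.2) * phi z.1.1.
transitivity (\sum_(z <- zbox3 K | cond z) F z).
  rewrite (bigID (fun z : int * int * int => ((z.1.1 %% 2)%Z == 0))) /=.
  rewrite big1 ?add0r; last by move=> z /andP[_ /eqP zo]; rewrite chi_even// mul0r.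
  pose h (z : int * int * int) := (z.1.1 + 2 * z.1.2, z.1.2, ((z.2 - z.1.2 - z.1.1) %/ 2)%Z).
  pose h' (z : int * int * int) := (z.1.1 - 2 * z.1.2, z.1.2, z.1.1 - z.1.2 + 2 * z.2).
  (* The bound on K leaves room in the box for Y and e, which are linear in X, r and n. *)
  rewrite (@reindex_seq _ _ _ (zbox3 K) _ cond _ h h'); rewrite ?uniq_zbox3//.
  - by apply: eq_bigr => -[[Y r] e] _; rewrite /F /h /=; congr (_ * phi _); ring.
  - move=> [[Y r] e] /=; rewrite /cond !mem_zbox3 /= !mem_zrange => /and3P[YK rK eK].
    move=> /and5P[Yo r0 Yer er /eqP E].
    have [n nE] : exists n, e = r + Y + 2 * n by exists ((e - r - Y) %/ 2)%Z; lia.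
    subst e.
    have -> : ((r + Y + 2 * n - r - Y) %/ 2)%Z = n by lia.
    have n0 : 0 < n by lia.
    have E' : (Y + 2 * r) ^+ 2 + 8 * r * n = N.
      by rewrite -[RHS](subrK (Y ^+ 2)) -E; ring.
    have : 0 < r * n by apply: mulr_gt0.
    have : r <= r * n by apply: ler_peMr; lia.
    have : n <= r * n by apply: ler_peMl; lia.
    have : `|Y + 2 * r| <= (Y + 2 * r) ^+ 2 by exact: norm1_ge.
    have : 8 * r * n = 8 * (r * n) by ring.
    move=> ? ? ? ? ?.
    split; first by apply/and3P; split; lia.
      by apply/andP; split; [apply/and3P; split=> //; apply/eqP | lia].
    by rewrite /h' /=; congr (_, _, _); lia.
  - move=> [[X r] n] /=; rewrite /cond !mem_zbox3 /= !mem_zrange => /and3P[XK rK nK].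
    move=> /andP[/and3P[r0 n0 /eqP E] Xo].
    have : 0 < r * n by apply: mulr_gt0.
    have : r <= r * n by apply: ler_peMr; lia.
    have : n <= r * n by apply: ler_peMl; lia.
    have : `|X| <= X ^+ 2 by exact: norm1_ge.
    have : 8 * r * n = 8 * (r * n) by ring.
    move=> ? ? ? ? ?.
    split; first by apply/and3P; split; lia.
      by apply/and5P; split; try lia; apply/eqP; rewrite -E; ring.
    rewrite /h /h' /=; congr (_, _, _); lia.
have Fneg : forall Y r e, F (- Y, r, e) = - F (Y, r, e).
  move=> Y r e; rewrite /F /= phiN !chi_shift chiN.
  by case: ifP => _; rewrite ?opprK mulNr ?opprK.
have Fswap : forall Y r r' e e', ((r - r') %% 2)%Z = 1 -> F (Y, r', e') = - F (Y, r, e).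
  move=> Y r r' e e' rr; rewrite /F /= !chi_shift.
  by case: ifP => rE; case: ifP => rE'; rewrite ?mulNr ?opprK//; lia.
(* Cancelled by Y -> -Y, which changes the sign of chi(Y + 2r). *)
rewrite (bigID (fun z : int * int * int => `|z.1.1| < z.2 - z.1.2)) /=.
rewrite (@sum_involution _ _ _ (fun z => (- z.1.1, z.1.2, z.2))) ?add0r;
  rewrite ?uniq_zbox3//; last first.
  move=> [[Y r] e] /=; rewrite /cond !mem_zbox3 /= !mem_zrange => /and3P[YK rK eK].
  move=> /andP[/and5P[Yo r0 Yer er /eqP E] Ye].
  split; [by apply/and3P; split; lia | | by congr (_, _, _); lia | exact: Fneg].
  by apply/andP; split; [apply/and5P; split; try lia; apply/eqP; lia | lia].
(* Cancelled by exchanging r and e: chi(Y + 2r) depends on r only through its parity, and e - r is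
   odd. *)
rewrite (bigID (fun z : int * int * int => (0 < z.2) && (`|z.2 - z.1.2| < - z.1.1))) /=.
rewrite (@sum_involution _ _ _ (fun z => (z.1.1, z.2, z.1.2))) ?add0r;
  rewrite ?uniq_zbox3//; last first.
  move=> [[Y r] e] /=; rewrite /cond !mem_zbox3 /= !mem_zrange => /and3P[YK rK eK].
  move=> /andP[/andP[/and5P[Yo r0 Yer er /eqP E] Ye] /andP[e0 er']].
  split=> //; [by apply/and3P; split; lia | | by apply: Fswap; lia].
  apply/andP; split; [apply/andP; split; [apply/and5P; split; try lia|lia]|lia].
(* Cancelled by (r, e) -> (-e, -r), which preserves both re and e - r. *)
rewrite (bigID (fun z : int * int * int => z.2 < 0)) /=.
rewrite (@sum_involution _ _ _ (fun z => (z.1.1, - z.2, - z.1.2))) ?add0r;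
  rewrite ?uniq_zbox3//; last first.
  move=> [[Y r] e] /=; rewrite /cond !mem_zbox3 /= !mem_zrange => /and3P[YK rK eK].
  move=> /andP[/andP[/andP[/and5P[Yo r0 Yer er /eqP E] Ye] _] e0].
  split=> //; [by apply/and3P; split; lia | | by congr (_, _, _); lia | by apply: Fswap; lia].
  apply/andP; split; last by lia.
  apply/andP; split; last by lia.
  apply/andP; split; [apply/and5P; split; try lia|lia].
(* Now Y < 0, and either e = 0 and N = Y^2, with Z = -Y and r = 2i + 1, or e - r = -Y and N = (2r -
   Y)^2, with Z = 2r - Y and Y = -(2i + 1). The two cases give the terms in phi(Z) and in phi(2i +
   1). *)
rewrite (bigID (fun z : int * int * int => z.2 == 0)) /=.
under [RHS]eq_bigr do rewrite mulrBr.
rewrite [RHS]big_split /=; congr +%R.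
  rewrite (@reindex_seq _ _ _ L (zbox3 K) [pred z | [&& 0 < z.1, (z.1 %% 2)%Z == 1,
     z.1 ^+ 2 == N%:Z & 2 * z.2%:Z + 1 < z.1]] _ (fun z => (- z.1, 2 * z.2%:Z + 1, 0))
     (fun z => (- z.1.1, absz (z.1.2 %/ 2)%Z))); rewrite ?uniq_zbox3//.
  - apply: eq_bigr => -[Z i] /= /and4P[Z0 Zo _ _].
    rewrite /F /= phiN chi_shift chiN opprK.
    by case: ifP => // iE; lia.
  - move=> [Z i]; rewrite memL /= mem_zbox3 !mem_zrange /cond /= => /andP[ZN iK].
    move=> /and4P[Z0 Zo /eqP ZE iZ]; split; first by apply/and3P; split; lia.
      apply/andP; split; last by [].
      apply/andP; split; last by lia.
      apply/andP; split; last by lia.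
      apply/andP; split; last by lia.
      apply/and5P; split; lia.
    by congr pair; lia.
  - move=> [[Y r] e]; rewrite memL /= mem_zbox3 !mem_zrange /cond /= => /and3P[YK rK eK].
    move=> /andP[/andP[/andP[/andP[/and5P[Yo r0 Yer er /eqP E] Ye] _] _] /eqP e0].
    subst e; have : `|Y| <= Y ^+ 2 by exact: norm1_ge.
    move=> ?; have Y2 : Y ^+ 2 = N by lia.
    split; first by apply/andP; split; lia.
      by apply/and4P; split; try lia; rewrite sqrrN Y2.
    by congr (_, _, _); lia.
rewrite (@reindex_seq _ _ _ L (zbox3 K) [pred z | [&& 0 < z.1, (z.1 %% 2)%Z == 1,
   z.1 ^+ 2 == N%:Z & 2 * z.2%:Z + 1 < z.1]] _
   (fun z => (- (2 * z.2%:Z + 1), ((z.1 - 2 * z.2%:Z - 1) %/ 2)%Z, ((z.1 + 2 * z.2%:Z + 1) %/ 2)%Z))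
   (fun z => (2 * z.1.2 - z.1.1, absz ((- z.1.1) %/ 2)%Z))); rewrite ?uniq_zbox3//.
- apply: eq_bigr => -[Z i] /= /and4P[Z0 Zo _ _].
  rewrite /F /= phiN.
  have -> : - (2 * i%:Z + 1) + 2 * ((Z - 2 * i%:Z - 1) %/ 2)%Z =
    Z + 2 * (- (2 * i%:Z + 1)) by lia.
  by rewrite chi_shift ifF ?mulNr//; lia.
- move=> [Z i]; rewrite memL /= mem_zbox3 !mem_zrange /cond /= => /andP[ZN iK].
  move=> /and4P[Z0 Zo /eqP ZE iZ].
  have [M ME] : exists M, Z = 2 * M + 1 by exists ((Z - 1) %/ 2)%Z; lia.
  subst Z.
  have -> : ((2 * M + 1 - 2 * i%:Z - 1) %/ 2)%Z = M - i%:Z by lia.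
  have -> : ((2 * M + 1 + 2 * i%:Z + 1) %/ 2)%Z = M + i%:Z + 1 by lia.
  split; first by apply/and3P; split; lia.
    apply/andP; split; last by lia.
    apply/andP; split; last by lia.
    apply/andP; split; last by lia.
    apply/andP; split; last by lia.
    apply/and5P; split; lia.
  by congr pair; lia.
- move=> [[Y r] e]; rewrite memL /= mem_zbox3 !mem_zrange /cond /= => /and3P[YK rK eK].
  move=> /andP[/andP[/andP[/andP[/and5P[Yo r0 Yer er /eqP E] Ye] Ye'] e0] e1].
  have eE : e = r - Y by lia.
  subst e.
  have EE : (2 * r - Y) ^+ 2 = N by lia.
  have : `|2 * r - Y| <= (2 * r - Y) ^+ 2 by exact: norm1_ge.
  move=> ?.
  split; first by apply/andP; split; lia.
    by apply/and4P; split; try lia; rewrite EE.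
  by congr (_, _, _); lia.
Qed.

(** For an even power phi, the difference phi(X - 2r) - phi(X + 2r) is a combination of products of
    odd powers of X and r, so the left side becomes a combination of products of [eta_ser] and
    [lambert]. The factor m clears the denominator in the closed form [psi] of a sum over odd
    numbers. *)
Lemma chi_divisor_moment (phi psi : int -> int) (m : int) (N K : nat) :
  (forall x, phi (- x) = phi x) -> (forall x, psi (- x) = - psi x) ->
  (forall M : nat, m * \sum_(i < M) (phi (2 * M%:Z + 1) - phi (2 * i%:Z + 1)) =
     psi (2 * M%:Z + 1)) ->
  (6 * N + 6 <= K)%N ->
  m * \sum_(z <- zbox3 K | [&& 0 < z.1.2, 0 < z.2 & z.1.1 ^+ 2 + 8 * z.1.2 * z.2 == N%:Z])
     chi z.1.1 * (phi (z.1.1 - 2 * z.1.2) - phi (z.1.1 + 2 * z.1.2)) =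
  tser norm1 (fun x => chi x * psi x) N.
Proof.
move=> phiN psiN psiE NK; pose cond (z : int * int * int) :=
  [&& 0 < z.1.2, 0 < z.2 & z.1.1 ^+ 2 + 8 * z.1.2 * z.2 == N%:Z].
have flip : \sum_(z <- zbox3 K | cond z) chi z.1.1 * phi (z.1.1 + 2 * z.1.2) =
  - \sum_(z <- zbox3 K | cond z) chi z.1.1 * phi (z.1.1 - 2 * z.1.2).
  rewrite -sumrN (@reindex_seq _ _ _ (zbox3 K) (zbox3 K) cond cond
    (fun z => (- z.1.1, z.1.2, z.2)) (fun z => (- z.1.1, z.1.2, z.2))) ?uniq_zbox3//.
  - apply: eq_bigr => -[[X r] n] _ /=; rewrite chiN mulNr.
    by rewrite (_ : - X + 2 * r = - (X - 2 * r)) ?phiN//; lia.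
  - move=> [[X r] n]; rewrite !mem_zbox3 !mem_zrange /cond /= sqrrN normrN => -> ->.
    by rewrite opprK.
  - move=> [[X r] n]; rewrite !mem_zbox3 !mem_zrange /cond /= sqrrN normrN => -> ->.
    by rewrite opprK.
under eq_bigr do rewrite mulrBr.
rewrite sumrB -/cond flip opprK /cond chi_divisor_sum//.
have -> : \sum_(z <- [seq (x, i) | x <- zrange N, i <- iota 0 K] |
     [&& 0 < z.1, (z.1 %% 2)%Z == 1, z.1 ^+ 2 == N%:Z & 2 * z.2%:Z + 1 < z.1])
     chi z.1 * (phi z.1 - phi (2 * z.2%:Z + 1)) =
   \sum_(x <- zrange N | [&& 0 < x, (x %% 2)%Z == 1 & x ^+ 2 == N%:Z])
     chi x * \sum_(i <- iota 0 K | 2 * i%:Z + 1 < x) (phi x - phi (2 * i%:Z + 1)).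
  rewrite big_mkcond big_allpairs_dep /= [RHS]big_mkcond; apply: eq_bigr => x _.
  case: ifP => [xP|xP].
    rewrite mulr_sumr [RHS]big_mkcond; apply: eq_bigr => i _.
    by move/and3P: xP => [-> -> ->].
  by rewrite big1// => i _; rewrite ifF//; apply: contraFF xP => /and4P[-> -> -> _].
have mE : forall x, 0 < x -> (x %% 2)%Z = 1 -> x <= N%:Z ->
  m * \sum_(i <- iota 0 K | 2 * i%:Z + 1 < x) (phi x - phi (2 * i%:Z + 1)) = psi x.
  move=> x x0 xo xN; have [M ME] : exists M : nat, x = 2 * M%:Z + 1.
    by exists (absz (x %/ 2)%Z); lia.
  rewrite {x}ME in x0 xo xN *; rewrite -psiE; congr (_ * _).
  rewrite -(big_mkord predT (fun i => phi (2 * M%:Z + 1) - phi (2 * i%:Z + 1))).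
  rewrite /index_iota subn0.
  apply: (@reindex_seq _ _ _ _ _ _ _ id id); rewrite ?iota_uniq// => i.
    by rewrite !mem_iota => ? ?; split=> //; lia.
  by rewrite !mem_iota => ? ?; split=> //; lia.
rewrite mulrDr mulr_sumr.
rewrite [X in X + X](_ : _ = \sum_(x <- zrange N | [&& 0 < x, (x %% 2)%Z == 1 & x ^+ 2 == N%:Z])
     chi x * psi x); last first.
  rewrite big_seq_cond [RHS]big_seq_cond; apply: eq_bigr => x.
  rewrite mem_zrange => /and4P[xN x0 /eqP xo xE].
  by rewrite mulrCA mE//; lia.
(* The two equal copies are the terms with x > 0 and with x < 0 of the series, as chi and psi are
   both odd. *)
rewrite /= /norm1 [RHS](bigID (fun x : int => (0 < x) && ((x %% 2)%Z == 1))) /=.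
congr +%R; first by apply: eq_bigl => x; rewrite andbA andbC.
rewrite [RHS](bigID (fun x : int => (x < 0) && ((x %% 2)%Z == 1))) /=.
rewrite [X in _ = _ + X]big1 ?addr0; last first.
  move=> x /andP[/andP[_ h1] h2]; rewrite chi_even ?mul0r//.
  by have [->//|xn0] := eqVneq x 0; lia.
rewrite (@reindex_seq _ _ _ (zrange N) (zrange N)
  (fun x => [&& x ^+ 2 == N%:Z & ~~ ((0 < x) && (x %% 2 == 1)%Z)] &&
            ((x < 0) && (x %% 2 == 1)%Z)) _ (fun x => - x) (fun x => - x)).
- by apply: eq_bigr => x _; rewrite chiN psiN mulrNN.
- exact: uniq_zrange.
- exact: uniq_zrange.
- move=> x; rewrite !mem_zrange normrN sqrrN opprK => -> /andP[/andP[-> _] h2].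
  by split=> //; rewrite andbT; lia.
- move=> x; rewrite !mem_zrange normrN sqrrN opprK => -> /and3P[h1 h2 ->].
  by split=> //=; lia.
Qed.

(** The divisor sum series sum_n sigma_e(n) s^(8n), kept as a sum over factorizations so that it
    multiplies termwise with [eta_ser]. *)
Definition lambert (e : nat) : fps int := Fps (fun N =>
  \sum_(z <- zbox2 N | [&& 0 < z.1, 0 < z.2 & 8 * z.1 * z.2 == N%:Z]) z.1 ^+ e).

Lemma eta_lambertM j e N K : (N <= K)%N -> (eta_ser j * lambert e) N =
  \sum_(z <- zbox3 K | [&& 0 < z.1.2, 0 < z.2 & z.1.1 ^+ 2 + 8 * z.1.2 * z.2 == N%:Z])
     chi z.1.1 * z.1.1 ^+ j * z.1.2 ^+ e.
Proof.
move=> NK; pose pos (z : int * int) := (0 < z.1) && (0 < z.2).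
rewrite (@indexed_byM _ _ (zrange K) [seq z <- zbox2 K | pos z] norm1
  (fun z => 8 * z.1 * z.2) (fun x => chi x * x ^+ j) (fun z => z.1 ^+ e) N).
- rewrite [RHS]big_mkcond /zbox3 big_allpairs_dep /= [in RHS]/zbox2 big_allpairs_dep /=.
  apply: eq_bigr => x _; rewrite [LHS]big_mkcond big_filter [LHS]big_mkcond.
  rewrite big_allpairs_dep /=; apply: eq_bigr => r _; apply: eq_bigr => n _.
  by rewrite /pos /norm1 /=; case: (0 < r) => //=; case: (0 < n) => //=; rewrite addrA.
- by move=> x _; apply: le_trans (norm1_ge x).
- by move=> [r n]; rewrite mem_filter /pos /= => /andP[/andP[r0 n0] _]; nia.
- exact: tser_indexed norm1_ge NK.
- move=> i iN /=; rewrite big_filter_cond.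
  apply: (@reindex_seq _ _ _ _ _ _ _ id id); rewrite ?uniq_zbox2// => -[r n].
    rewrite !mem_zbox2 !mem_zrange /pos /= => /andP[rK nK].
    move=> /andP[/andP[r0 n0] /eqP E]; split=> //; last by rewrite r0 n0 E eqxx.
    by apply/andP; split; nia.
  rewrite !mem_zbox2 !mem_zrange /pos /= => /andP[rK nK] /and3P[-> -> ->].
  by split=> //; lia.
Qed.

Lemma lambert_sigma e :
  lambert e = fps_expand 8 (Fps (fun n => if n == 0%N then 0 else (sigma e n)%:Z)).
Proof.
apply: fpsP => N; rewrite fpsEexpand; case: ifP => [dN|dN]; last first.
  rewrite /= big1// => -[r n] /= /and3P[r0 n0 /eqP E].
  by exfalso; move/negP: dN; apply; apply/dvdnP; exists (absz (r * n)); nia.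
have [M ->] := dvdnP dN; rewrite mulnK//.
case: M => [|M].
  rewrite /= big1// => -[r n] /= /and3P[r0 n0 /eqP E].
  by exfalso; have := mulr_gt0 r0 n0; lia.
rewrite /= /sigma (big_morph Posz PoszD (erefl _)).
rewrite (@reindex_seq _ _ _ (divisors M.+1) (zbox2 (M.+1 * 8)) predT _
  (fun d => (d%:Z, (M.+1 %/ d)%N%:Z)) (fun z => absz z.1)).
- by apply: eq_bigr => d _ /=; elim: (e) => // f IH; rewrite expnS PoszM exprS IH.
- exact: divisors_uniq.
- exact: uniq_zbox2.
- move=> d; rewrite -dvdn_divisors// mem_zbox2 !mem_zrange => dM _.
  have d0 := dvdn_gt0 (ltn0Sn M) dM.
  have dle := dvdn_leq (ltn0Sn M) dM.
  have q0 : (0 < M.+1 %/ d)%N by rewrite (divn_gt0 _ d0).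
  have ME := divnK dM.
  have qle := leq_div M.+1 d.
  move: (M.+1 %/ d)%N q0 ME qle => q q0 ME qle.
  split=> //=; first by apply/andP; split; lia.
  by apply/and3P; split; [lia | lia | apply/eqP; rewrite -ME; lia].
- move=> [r n]; rewrite mem_zbox2 /= => _ /and3P[r0 n0 /eqP E].
  have nr : n * r = M.+1%:Z by lia.
  have ME : (M.+1 = absz n * absz r)%N by rewrite -abszM nr.
  have rE : (0 < absz r)%N by lia.
  rewrite -dvdn_divisors// {1 2}ME dvdn_mull// mulnK//; split=> //.
  by congr pair; lia.
Qed.

(** The moment of x^2: (X - 2r)^2 - (X + 2r)^2 = -8Xr, and 3 clears the sum of odd squares, so 24 =
    3 * 8. *)
Lemma eta_lambert1 : eta_ser 3 = (1 - 24 * lambert 1) * eta_ser 1.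
Proof.
have E : - 24 * (eta_ser 1 * lambert 1) = eta_ser 3 - eta_ser 1.
  apply: fpsP => N; have NK : (N <= 6 * N + 6)%N by lia.
  rewrite mulNr fpsEopp fpsEnat (@eta_lambertM _ _ _ _ NK).
  rewrite fpsEsub /eta_ser.
  transitivity (tser norm1 (fun x => chi x * (x ^+ 3 - x)) N); last first.
    by rewrite /= -sumrB; apply: eq_bigr => x _; ring.
  rewrite -(@chi_divisor_moment (fun x => x ^+ 2) (fun x => x ^+ 3 - x) 3 N (6 * N + 6))//.
  - by rewrite !mulr_sumr -sumrN; apply: eq_bigr => -[[x r] n] _ /=; ring.
  - by move=> x; ring.
  - by move=> x; ring.
  - move=> M; have -> : \sum_(i < M) ((2 * M%:Z + 1) ^+ 2 - (2 * i%:Z + 1) ^+ 2) =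
       M%:Z * (2 * M%:Z + 1) ^+ 2 - \sum_(i < M) (2 * i%:Z + 1) ^+ 2.
      by rewrite sumrB sumr_const card_ord -mulr_natl; ring.
    have S : 3 * \sum_(i < M) (2 * i%:Z + 1) ^+ 2 = M%:Z * (4 * M%:Z ^+ 2 - 1).
      elim: M => [|M IH]; first by rewrite big_ord0; ring.
      by rewrite big_ord_recr /= mulrDr IH intS; ring.
    by rewrite mulrBr S; ring.
by rewrite mulrBl mul1r -mulrA (mulrC (lambert 1)) -mulNr E; ring.
Qed.

(** The moment of x^4, with difference -16 X^3 r - 64 X r^3 and m = 15: 15 * 16 = 240 and 15 * 64 =
    4 * 240. *)
Lemma eta_lambert3 :
  6 * eta_ser 5 = 10 * ((1 - 24 * lambert 1) * eta_ser 3)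
                  - 4 * ((1 + 240 * lambert 3) * eta_ser 1).
Proof.
have E : - 240 * (eta_ser 3 * lambert 1) - 960 * (eta_ser 1 * lambert 3) =
    6 * eta_ser 5 - 10 * eta_ser 3 + 4 * eta_ser 1.
  apply: fpsP => N; have NK : (N <= 6 * N + 6)%N by lia.
  rewrite fpsEsub mulNr fpsEopp fpsEadd fpsEsub !fpsEnat.
  rewrite !(@eta_lambertM _ _ _ _ NK).
  transitivity (tser norm1 (fun x => chi x * (6 * x ^+ 5 - 10 * x ^+ 3 + 4 * x)) N); last first.
    by rewrite /= !mulr_sumr -sumrB -big_split; apply: eq_bigr => x _ /=; ring.
  rewrite -(@chi_divisor_moment (fun x => x ^+ 4)
    (fun x => 6 * x ^+ 5 - 10 * x ^+ 3 + 4 * x) 15 N (6 * N + 6))//.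
  - by rewrite !mulr_sumr -sumrN -sumrB; apply: eq_bigr => -[[x r] n] _ /=; ring.
  - by move=> x; ring.
  - by move=> x; ring.
  - move=> M; have -> : \sum_(i < M) ((2 * M%:Z + 1) ^+ 4 - (2 * i%:Z + 1) ^+ 4) =
       M%:Z * (2 * M%:Z + 1) ^+ 4 - \sum_(i < M) (2 * i%:Z + 1) ^+ 4.
      by rewrite sumrB sumr_const card_ord -mulr_natl; ring.
    have S : 15 * \sum_(i < M) (2 * i%:Z + 1) ^+ 4 =
        M%:Z * (48 * M%:Z ^+ 4 - 40 * M%:Z ^+ 2 + 7).
      elim: M => [|M IH]; first by rewrite big_ord0; ring.
      by rewrite big_ord_recr /= mulrDr IH intS; ring.
    by rewrite mulrBr S; ring.
transitivity ((6 * eta_ser 5 - 10 * eta_ser 3 + 4 * eta_ser 1)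
  + 10 * eta_ser 3 - 4 * eta_ser 1); first by ring.
by rewrite -E; ring.
Qed.

(** The moment of x^6, with difference -24 X^5 r - 320 X^3 r^3 - 384 X r^5 and m = 21: 21 * 24 =
    504, 21 * 320 = 28 * 240 and 21 * 384 = 16 * 504. *)
Lemma eta_lambert5 :
  9 * eta_ser 7 = 21 * ((1 - 24 * lambert 1) * eta_ser 5)
                  - 28 * ((1 + 240 * lambert 3) * eta_ser 3)
                  + 16 * ((1 - 504 * lambert 5) * eta_ser 1).
Proof.
have E : - 504 * (eta_ser 5 * lambert 1) - 28 * (240 * (eta_ser 3 * lambert 3))
      - 16 * (504 * (eta_ser 1 * lambert 5)) =
    9 * eta_ser 7 - 21 * eta_ser 5 + 28 * eta_ser 3 - 16 * eta_ser 1.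
  apply: fpsP => N; have NK : (N <= 6 * N + 6)%N by lia.
  rewrite !(fpsEsub, fpsEadd) mulNr fpsEopp !fpsEnat.
  rewrite !(@eta_lambertM _ _ _ _ NK).
  transitivity (tser norm1 (fun x => chi x *
    (9 * x ^+ 7 - 21 * x ^+ 5 + 28 * x ^+ 3 - 16 * x)) N); last first.
    by rewrite /= !mulr_sumr -sumrB -big_split -sumrB; apply: eq_bigr => x _ /=; ring.
  rewrite -(@chi_divisor_moment (fun x => x ^+ 6)
    (fun x => 9 * x ^+ 7 - 21 * x ^+ 5 + 28 * x ^+ 3 - 16 * x) 21 N (6 * N + 6))//.
  - by rewrite !mulr_sumr -sumrN -!sumrB; apply: eq_bigr => -[[x r] n] _ /=; ring.
  - by move=> x; ring.
  - by move=> x; ring.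
  - move=> M; have -> : \sum_(i < M) ((2 * M%:Z + 1) ^+ 6 - (2 * i%:Z + 1) ^+ 6) =
       M%:Z * (2 * M%:Z + 1) ^+ 6 - \sum_(i < M) (2 * i%:Z + 1) ^+ 6.
      by rewrite sumrB sumr_const card_ord -mulr_natl; ring.
    have S : 21 * \sum_(i < M) (2 * i%:Z + 1) ^+ 6 =
        M%:Z * (192 * M%:Z ^+ 6 - 336 * M%:Z ^+ 4 + 196 * M%:Z ^+ 2 - 31).
      elim: M => [|M IH]; first by rewrite big_ord0; ring.
      by rewrite big_ord_recr /= mulrDr IH intS; ring.
    by rewrite mulrBr S; ring.
transitivity ((9 * eta_ser 7 - 21 * eta_ser 5 + 28 * eta_ser 3 - 16 * eta_ser 1)
    + 21 * eta_ser 5 - 28 * eta_ser 3 + 16 * eta_ser 1); first by ring.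
by rewrite -E; ring.
Qed.

(** * Ramanujan's differential equations *)

Lemma eta_ser1_neq0 : eta_ser 1 != 0.
Proof.
apply/eqP => /(congr1 (fun f : fps int => f 1%N)); rewrite fpsE0 /=.
(* Both x = 1 and x = -1 contribute 1, so the coefficient of s is 2. *)
rewrite (@reindex_seq _ _ _ [:: 1; -1 : int] (zrange 1) predT _ id id).
- by rewrite !big_cons big_nil.
- by [].
- exact: uniq_zrange.
- by move=> z; rewrite !inE => /orP[] /eqP-> _; rewrite mem_zrange.
- move=> z; rewrite mem_zrange !inE => z1 /eqP zE; split=> //.
  by apply/orP; rewrite /norm1 in zE; nia.
Qed.

(* [lincomb [:: scaled_eq c1 E1; ...; scaled_eq cn En]] proves an equation which
   is the linear combination of the equations Ei with coefficients ci. *)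
Definition scaled_eq (S : comNzRingType) (c a b : S) (E : a = b) : {x : S | x = 0} :=
  exist _ (c * (a - b)) (etrans (congr1 (fun y => c * (y - b)) E)
    (etrans (congr1 ( *%R c) (subrr b)) (mulr0 c))).

Lemma lincomb (S : comNzRingType) (r : seq {x : S | x = 0}) (z w : S) :
  z - w = foldr (fun e s => sval e + s) 0 r -> z = w.
Proof.
move=> zw; apply/eqP; rewrite -subr_eq0 zw; apply/eqP => {zw}.
by elim: r => //= -[x /= ->] r ->; rewrite addr0.
Qed.

Tactic Notation "lincomb" uconstr(r) := refine (lincomb (r := r) _); rewrite /scaled_eq /=; ring.

Section Ramanujan.
Variables t P Q R : fps int.
Hypothesis t_neq0 : t != 0.
Hypothesis t3 : D t = P * t.
Hypothesis t5E : 6 * D (D t) = 10 * (P * D t) - 4 * (Q * t).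
Hypothesis t7E : 9 * D (D (D t)) = 21 * (P * D (D t)) - 28 * (Q * D t) + 16 * (R * t).

Let t5 : D (D t) = (D P + P ^+ 2) * t.
Proof. by rewrite t3 fpsDM t3; ring. Qed.

Let t7 : D (D (D t)) = (D (D P) + 3 * P * D P + P ^+ 3) * t.
Proof. by rewrite t5 expr2 fpsDM raddfD /= fpsDM t3; ring. Qed.

Let t9 : D (D (D (D t))) =
  (D (D (D P)) + 4 * P * D (D P) + 3 * (D P) ^+ 2 + 6 * P ^+ 2 * D P + P ^+ 4) * t.
Proof.
rewrite t7 fpsDM t3 !raddfD /= -mulrA fpsD_natM.
by rewrite (_ : P ^+ 3 = P * (P * P)) ?fpsDM; ring.
Qed.

Let tcancel (f g : fps int) (n : nat) :
  (n != 0)%N -> n%:R * f * t = n%:R * g * t -> f = g.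
Proof.
move=> n0 fg; apply: (@fps_mulfI _ n%:R); first exact: fps_nat_neq0.
by apply: (fps_mulfI t_neq0); rewrite ![t * _]mulrC.
Qed.

Lemma ramanujan_E2 : 3 * D P = 2 * (P ^+ 2 - Q).
Proof.
by apply: (@tcancel _ _ 2) => //; have := t5E; rewrite t5 t3 => E; lincomb [:: scaled_eq 1 E].
Qed.

Let DDP : 3 * D (D P) = 4 * P * D P - 2 * D Q.
Proof. by rewrite -fpsD_natM ramanujan_E2 fpsD_natM raddfB /= expr2 fpsDM; ring. Qed.

Lemma ramanujan_E4 : 3 * D Q = 8 * (P * Q - R).
Proof.
apply: (@tcancel _ _ 2) => //; have := t7E; rewrite t7 t5 t3 => E.
lincomb [:: scaled_eq (-1) E;
  scaled_eq (3 * t) DDP;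
  scaled_eq (6 * P * t) ramanujan_E2].
Qed.

Variables A B : fps int.
Hypothesis wr : t ^+ 2 = A * D B - D A * B.
Hypothesis tv2 : t * D (D t) - D t ^+ 2 = 2 * (D A * D (D B) - D (D A) * D B).
Hypothesis tv4 :
  t * D (D (D (D t))) - 4 * (D t * D (D (D t))) + 3 * D (D t) ^+ 2 =
  8 * (D (D A) * D (D (D B)) - D (D (D A)) * D (D B)).

Let wr' : 2 * P * t ^+ 2 = A * D (D B) - D (D A) * B.
Proof.
have := congr1 D wr; rewrite expr2 raddfB /= !fpsDM t3 => E.
lincomb [:: scaled_eq 1 E].
Qed.

Let tv2' : t ^+ 2 * D P = 2 * (D A * D (D B) - D (D A) * D B).
Proof. by rewrite -tv2 t5 t3; ring. Qed.

Let t2cancel (f g : fps int) : t ^+ 2 * f = t ^+ 2 * g -> f = g.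
Proof. by rewrite expr2 -!mulrA => /(fps_mulfI t_neq0)/(fps_mulfI t_neq0). Qed.

(** The 3 by 3 determinant in which the row (A, A', A'') occurs twice, next to (B, B', B''),
    vanishes. Its expansion has the three minors t^2, 2 P t^2 and t^2 P' / 2 as coefficients of A'',
    A' and A. *)
Lemma theta_ode_fst : 2 * D (D A) = 4 * P * D A - D P * A.
Proof.
apply: t2cancel.
lincomb [:: scaled_eq (2 * D (D A)) wr;
  scaled_eq (- 2 * D A) wr';
  scaled_eq A tv2'].
Qed.

Let theta_ode_snd : 2 * D (D B) = 4 * P * D B - D P * B.
Proof.
apply: t2cancel.
lincomb [:: scaled_eq (2 * D (D B)) wr;
  scaled_eq (- 2 * D B) wr';
  scaled_eq B tv2'].
Qed.

Let DDDA : 2 * D (D (D A)) = 3 * D P * D A + 4 * P * D (D A) - D (D P) * A.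
Proof.
rewrite -fpsD_natM theta_ode_fst raddfB /= -mulrA fpsD_natM !fpsDM; ring.
Qed.

Let DDDB : 2 * D (D (D B)) = 3 * D P * D B + 4 * P * D (D B) - D (D P) * B.
Proof.
rewrite -fpsD_natM theta_ode_snd raddfB /= -mulrA fpsD_natM !fpsDM; ring.
Qed.

(** The differentiated equations of A and B eliminate the third derivatives, which reduces this
    minor to the two lower ones. *)
Let DA2B3 : 8 * (D (D A) * D (D (D B)) - D (D (D A)) * D (D B)) =
  t ^+ 2 * (8 * P * D (D P) - 6 * D P ^+ 2).
Proof.
have := DDDA; have := DDDB; have := tv2'; have := wr'.
move: (D A) (D B) (D P) (D (D P)) (D (D A)) (D (D B)) (D (D (D A))) (D (D (D B))).
move=> A1 B1 P1 P2 A2 B2 A3 B3 wr2 tv B3E A3E.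
apply: (@etrans _ _ (- 12 * P1 * (A1 * B2 - A2 * B1) + 4 * P2 * (A * B2 - A2 * B))).
  lincomb [:: scaled_eq (4 * A2) B3E;
  scaled_eq (- 4 * B2) A3E].
lincomb [:: scaled_eq (6 * P1) tv;
  scaled_eq (- 4 * P2) wr2].
Qed.

(** In terms of P the left side of [tv4] collapses to t^2 (P''' + 6 P'^2). *)
Lemma chazy : D (D (D P)) = 8 * P * D (D P) - 12 * D P ^+ 2.
Proof.
apply: t2cancel; have := tv4; rewrite DA2B3 t9 t7 t5 t3.
move: (D P) (D (D P)) (D (D (D P))) => P1 P2 P3 E.
lincomb [:: scaled_eq 1 E].
Qed.

(** The equation for P differentiated twice contains P''' and Q''; Chazy's equation replaces P''',
    and the differentiated equation for Q trades Q'' for R'. *)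
Lemma ramanujan_E6 : D R = 4 * (P * R - Q ^+ 2).
Proof.
have DDDP : 3 * D (D (D P)) = 4 * D P ^+ 2 + 4 * P * D (D P) - 2 * D (D Q).
  by rewrite -fpsD_natM DDP raddfB /= -mulrA !fpsD_natM fpsDM; ring.
have DDQ : 3 * D (D Q) = 8 * (D P * Q + P * D Q - D R).
  by rewrite -fpsD_natM ramanujan_E4 fpsD_natM raddfB /= fpsDM.
apply: (@fps_mulfI _ 16); first exact: fps_nat_neq0.
pose S := - 60 * P * D (D P) + 120 * D P ^+ 2 - 16 * D P * Q - 16 * P * D Q.
have S0 : 16 * D R = - S.
  rewrite /S; lincomb [:: scaled_eq 9 chazy;
  scaled_eq (- 3) DDDP;
  scaled_eq 2 DDQ].
have S1 : - S = 120 * - D P ^+ 2 + 80 * P ^+ 2 * D P + 16 * D P * Q - 24 * P * D Q.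
  rewrite /S; lincomb [:: scaled_eq (20 * P) DDP].
rewrite S0 S1.
lincomb [:: scaled_eq (- 8 * P) ramanujan_E4;
  scaled_eq (- 40 * D P + 32 * Q) ramanujan_E2].
Qed.

End Ramanujan.

(** * Eisenstein series and theta as series in q *)

Definition sigma_ser (e : nat) : fps int :=
  Fps (fun n => if n == 0%N then 0 else (sigma e n)%:Z).
Definition E2_ser : fps int := 1 - 24 * sigma_ser 1.
Definition E4_ser : fps int := 1 + 240 * sigma_ser 3.
Definition E6_ser : fps int := 1 - 504 * sigma_ser 5.
Definition theta_ser : fps int := Fps (fun n => (theta_coef n)%:Z).

HB.instance Definition _ := GRing.isZmodMorphism.Build (fps int) (fps int)
  (@fps_expand int 8) (@fps_expand_is_zmod int 8).
HB.instance Definition _ := GRing.isMonoidMorphism.Build (fps int) (fps int)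
  (@fps_expand int 8) (@fps_expand_is_monoid int 8 isT).

Local Notation e8 := (@fps_expand int 8).

(** Only even u = 2w contribute, and 2u^2 = 8w^2, so s^(2u^2) = q^(w^2). *)
Lemma expand_theta : e8 theta_ser = theta_even.
Proof.
apply: fpsP => N; rewrite fpsEexpand; case: ifP => [/dvdnP[m ->]|dN]; last first.
  rewrite /= big1// => u /eqP uN; case: eqP => // ue; exfalso.
  move/negP: dN; apply; rewrite /norm2 in uN.
  have [w wE] : exists w, u = 2 * w by exists (u %/ 2)%Z; lia.
  by apply/dvdnP; exists (absz (w ^+ 2)); subst u; nia.
rewrite mulnK//= /theta_coef -sum1_card (big_morph Posz PoszD (erefl _)).
rewrite big_mkcond /= -big_mkcond /=.
rewrite [RHS](bigID (fun u : int => (u %% 2)%Z == 0)) /= [X in _ = _ + X]big1 ?addr0; last first.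
  by move=> u /andP[_ /negPf->].
rewrite [RHS](eq_bigr (fun=> 1)); last by move=> u /andP[_ /eqP->].
rewrite (@reindex_seq _ _ _ (index_enum 'I_(m.*2.+1)) (zrange (m * 8))
  (fun i : 'I_(m.*2.+1) => ((i : nat)%:Z - m%:Z) ^+ 2 == m%:Z) _
  (fun i : 'I_(m.*2.+1) => 2 * ((i : nat)%:Z - m%:Z))
  (fun u => inord (absz ((u %/ 2)%Z + m%:Z)))).
- by [].
- exact: index_enum_uniq.
- exact: uniq_zrange.
- move=> i _ /eqP iE; have im := ltn_ord i; rewrite mem_zrange /norm2.
  split; [lia | apply/andP; split; [apply/eqP; nia | lia] |].
  by apply: val_inj; rewrite /= inordK; lia.
- move=> u _ /andP[/eqP]; rewrite /norm2 => uE ue.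
  have [w wE] : exists w, u = 2 * w by exists (u %/ 2)%Z; lia.
  have wE2 : w ^+ 2 = m by subst u; nia.
  have -> : (u %/ 2)%Z = w by lia.
  have : `|w| <= w ^+ 2 := norm1_ge w.
  move=> wle; rewrite mem_index_enum inordK; last by lia.
  have -> : (absz (w + m%:Z))%:Z - m%:Z = w by lia.
  by rewrite wE2 eqxx wE.
Qed.

Section RamanujanSeries.

Let lambert_expand e : lambert e = e8 (sigma_ser e).
Proof. exact: lambert_sigma. Qed.

Let E2_expand : 1 - 24 * lambert 1 = e8 E2_ser.
Proof. by rewrite rmorphB rmorphM rmorph_nat rmorph1 lambert_expand. Qed.

Let E4_expand : 1 + 240 * lambert 3 = e8 E4_ser.
Proof. by rewrite rmorphD rmorphM rmorph_nat rmorph1 lambert_expand. Qed.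

Let E6_expand : 1 - 504 * lambert 5 = e8 E6_ser.
Proof. by rewrite rmorphB rmorphM rmorph_nat rmorph1 lambert_expand. Qed.

Let D_expand f : fpsD (e8 f) = 8 * e8 (fpsD f).
Proof. exact: fpsD_expand. Qed.

Let eta3 : fpsD (eta_ser 1) = e8 E2_ser * eta_ser 1.
Proof. by rewrite fpsD_eta_ser eta_lambert1 E2_expand. Qed.

Let eta5 : 6 * fpsD (fpsD (eta_ser 1)) =
  10 * (e8 E2_ser * fpsD (eta_ser 1)) - 4 * (e8 E4_ser * eta_ser 1).
Proof. by rewrite !fpsD_eta_ser eta_lambert3 E2_expand E4_expand. Qed.

Let eta7 : 9 * fpsD (fpsD (fpsD (eta_ser 1))) =
  21 * (e8 E2_ser * fpsD (fpsD (eta_ser 1)))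
  - 28 * (e8 E4_ser * fpsD (eta_ser 1)) + 16 * (e8 E6_ser * eta_ser 1).
Proof. by rewrite !fpsD_eta_ser eta_lambert5 E2_expand E4_expand E6_expand. Qed.

Let tv2 : eta_ser 1 * fpsD (fpsD (eta_ser 1)) - fpsD (eta_ser 1) ^+ 2 =
  2 * (fpsD theta_even * fpsD (fpsD theta_odd)
       - fpsD (fpsD theta_even) * fpsD theta_odd).
Proof. by rewrite !fpsD_eta_ser transvectant2_eta. Qed.

Let tv4 : eta_ser 1 * fpsD (fpsD (fpsD (fpsD (eta_ser 1))))
  - 4 * (fpsD (eta_ser 1) * fpsD (fpsD (fpsD (eta_ser 1))))
  + 3 * fpsD (fpsD (eta_ser 1)) ^+ 2 =
  8 * (fpsD (fpsD theta_even) * fpsD (fpsD (fpsD theta_odd))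
       - fpsD (fpsD (fpsD theta_even)) * fpsD (fpsD theta_odd)).
Proof. by rewrite !fpsD_eta_ser transvectant4_eta. Qed.

(** The multiplier absorbs the factors 8 that arise because the Euler operator in s is 8 times the
    one in q. *)
Let e8_inj n (f g : fps int) : (n != 0)%N -> n%:R * e8 f = n%:R * e8 g -> f = g.
Proof. by move=> n0 /(fps_mulfI (fps_nat_neq0 _ n0))/fps_expand_inj; apply. Qed.

Lemma ramanujan_E2_ser : 12 * fpsD E2_ser = E2_ser ^+ 2 - E4_ser.
Proof.
apply: (@e8_inj 2) => //; have := ramanujan_E2 eta_ser1_neq0 eta3 eta5.
rewrite D_expand [E2_ser ^+ 2]expr2 !(rmorphM, rmorphB, rmorph_nat) /= => E.
lincomb [:: scaled_eq 1 E].
Qed.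

Lemma ramanujan_E4_ser : 3 * fpsD E4_ser = E2_ser * E4_ser - E6_ser.
Proof.
apply: (@e8_inj 8) => //; have := ramanujan_E4 eta_ser1_neq0 eta3 eta5 eta7.
rewrite D_expand !(rmorphM, rmorphB, rmorph_nat) /= => E.
lincomb [:: scaled_eq 1 E].
Qed.

Lemma ramanujan_E6_ser : 2 * fpsD E6_ser = E2_ser * E6_ser - E4_ser ^+ 2.
Proof.
apply: (@e8_inj 4) => //.
have := ramanujan_E6 eta_ser1_neq0 eta3 eta5 eta7 wronskian_eta tv2 tv4.
rewrite D_expand [E4_ser ^+ 2]expr2 !(rmorphM, rmorphB, rmorph_nat) /= => E.
lincomb [:: scaled_eq 1 E].
Qed.

Lemma theta_ser_ode : 192 * fpsD (fpsD theta_ser) =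
  48 * E2_ser * fpsD theta_ser - (E2_ser ^+ 2 - E4_ser) * theta_ser.
Proof.
rewrite -ramanujan_E2_ser; apply: (@e8_inj 8) => //.
have := theta_ode_fst eta_ser1_neq0 eta3 wronskian_eta tv2.
rewrite -expand_theta !(D_expand, fpsD_natM) !(rmorphM, rmorphB, rmorph_nat) /= => E.
lincomb [:: scaled_eq 12 E].
Qed.

End RamanujanSeries.

(** * The Kaneko-Zagier operator in weight 1/2 *)

(** With Q = E4 and R = E6, all of these for m <= n have weight 12 n + 4 a + 6 b. Using 1728 Delta =
    Q^3 - R^2 instead of Delta avoids division, so the same formula serves over [int], the reals and
    F_p. *)
Definition wt_monomial (S : comNzRingType) (Q R : fps S) (n a b m : nat) : fps S :=
  Q ^+ (3 * (n - m) + a) * (Q ^+ 3 - R ^+ 2) ^+ m * R ^+ b.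

Lemma wt_monomial_ord (S : comNzRingType) (Q R : fps S) n a b m :
  let V := Q ^+ 3 - R ^+ 2 in
  Q 0%N = 1 -> R 0%N = 1 -> V 0%N = 0 ->
  fps_ord m (wt_monomial Q R n a b m) /\ wt_monomial Q R n a b m m = V 1%N ^+ m.
Proof.
move=> V Q0 R0 V0.
have [q1 q2] := fps_ordX (3 * (n - m) + a) (fps_ord0 Q).
have [r1 r2] := fps_ordX b (fps_ord0 R).
have Vord : fps_ord 1 V by case.
have [v1 v2] := fps_ordX m Vord; rewrite mul0n mul1n in q1 q2 r1 r2 v1 v2.
have [qv1 qv2] := fps_ordM q1 v1; rewrite add0n in qv1 qv2.
have [x1 x2] := fps_ordM qv1 r1; rewrite addn0 in x1 x2; split=> //.
by rewrite x2 qv2 q2 v2 r2 Q0 R0 !expr1n mulr1 mul1r.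
Qed.

Section KanekoZagier.
Variables (F : fieldType) (P Q R : fps F).
Hypothesis DP : 12 * D P = P ^+ 2 - Q.
Hypothesis DQ : 3 * D Q = P * Q - R.
Hypothesis DR : 2 * D R = P * R - Q ^+ 2.
Let V := Q ^+ 3 - R ^+ 2.

Let DV : D V = P * V.
Proof.
rewrite /V raddfB /= !exprS expr0 !mulr1 !fpsDM.
lincomb [:: scaled_eq (Q ^+ 2) DQ; scaled_eq (- R) DR].
Qed.

Let DVX m : D (V ^+ m) = m%:R * P * V ^+ m.
Proof.
elim: m => [|m IH]; first by rewrite expr0 (fpsD_nat _ 1) !mul0r.
by rewrite exprS fpsDM IH DV -natr1; ring.
Qed.

Section Monomial.
Variables (al m : nat).
Let X := Q ^+ al * V ^+ m.
Let s : fps F := al%:R + 3 * m%:R.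

Let DX : 3 * Q * D X = (s * (P * Q) - al%:R * R) * X.
Proof.
rewrite /X /s fpsDM DVX; have E := fpsDX Q al.
lincomb [:: scaled_eq (3 * V ^+ m) E; scaled_eq (al%:R * Q ^+ al * V ^+ m) DQ].
Qed.

Let DDX : 3 * D Q * D X + 3 * Q * D (D X) =
  (s * (D P * Q + P * D Q) - al%:R * D R) * X + (s * (P * Q) - al%:R * R) * D X.
Proof.
have sE : s = (al + 3 * m)%:R by rewrite natrD natrM.
have := congr1 D DX; rewrite sE -[3 * Q * D X]mulrA fpsD_natM !fpsDM raddfB /=.
by rewrite !fpsD_natM fpsDM => <-; ring.
Qed.

(* 192 times the Kaneko-Zagier operator D^2 - (k+1)/6 E2 D + k(k+1)/12 E2'
   for k = 1/2. *)
Definition kz_op (f : fps F) := 192 * D (D f) - 48 * P * D f + (P ^+ 2 - Q) * f.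

(** The hypothesis says that the weight 4 al + 12 m of X is 1/2 in F. The factor 3 Q^2 clears the
    denominators from differentiating a power of Q twice. The first coefficient is 3 times the
    indicial polynomial 192 m^2 - 48 m, whose roots 0 and 1/4 are the leading q-exponents of theta
    and B. *)
Lemma kz_op_monomial0 : 8 * (al%:R : fps F) = 1 - 24 * m%:R ->
  3 * Q ^+ 2 * kz_op X = 144 * m%:R * (4 * m%:R - 1) * (Q ^+ 3 * X)
    - (24 * m%:R - 1) * (24 * m%:R + 7) * (V * X).
Proof.
have := DDX; have := DX; rewrite /s /kz_op /V.
move: X (al%:R : fps F) (m%:R : fps F) => Z a n E1 E2 Ea.
lincomb (let e := 8 * a - (1 - 24 * n) in let S := (a + 3 * n) * (P * Q) - a * R in
  [:: scaled_eq (192 * Q) E2; scaled_eq (64 * (S - 3 * D Q) - 48 * P * Q) E1;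
  scaled_eq (- 64 * S * Z + 64 * (a + 3 * n) * P * Q * Z) DQ;
  scaled_eq (16 * (a + 3 * n) * Q ^+ 2 * Z) DP; scaled_eq (- 96 * a * Q * Z) DR;
  scaled_eq (Z * (P ^+ 2 * Q ^+ 2 * (8 * (a + 3 * n) - 3) - 16 * a * P * Q * R
    + Q ^+ 3 * (e + 4 - 48 * n)) - (e - 6 - 48 * n) * (Q ^+ 3 - R ^+ 2) * Z) Ea]).
Qed.

(** The factor R adds 6 to the weight, so here 4 al + 12 m + 6 = 1/2. *)
Lemma kz_op_monomial1 : 8 * (al%:R : fps F) = - 11 - 24 * m%:R ->
  3 * Q ^+ 2 * kz_op (X * R) = 144 * m%:R * (4 * m%:R - 1) * (Q ^+ 3 * (X * R))
    - (24 * m%:R + 11) * (24 * m%:R + 19) * (V * (X * R)).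
Proof.
have DDR : 2 * D (D R) = D P * R + P * D R - 2 * Q * D Q.
  by rewrite -fpsD_natM DR raddfB /= expr2 !fpsDM; ring.
have DXR : D (X * R) = D X * R + X * D R by rewrite fpsDM.
have DDXR : D (D (X * R)) = D (D X) * R + 2 * D X * D R + X * D (D R).
  by rewrite DXR raddfD /= !fpsDM; ring.
rewrite /kz_op DDXR DXR {DXR DDXR}; have := DDX; have := DX; rewrite /s /V.
move: X (al%:R : fps F) (m%:R : fps F) => Z a n E1 E2 Ea.
lincomb (let e := 8 * a - (- 11 - 24 * n) in let S := (a + 3 * n) * (P * Q) - a * R in
  [:: scaled_eq (192 * Q * R) E2;
  scaled_eq (64 * (S - 3 * D Q) * R + 384 * Q * D R - 48 * P * Q * R) E1;
  scaled_eq (- 64 * S * Z * R + 64 * (a + 3 * n) * P * Q * Z * R - 192 * Q ^+ 3 * Z) DQ;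
  scaled_eq (16 * (a + 3 * n) * Q ^+ 2 * Z * R + 24 * Q ^+ 2 * Z * R) DP;
  scaled_eq (- 96 * a * Q * Z * R + 192 * Q * S * Z + 72 * Q ^+ 2 * P * Z) DR;
  scaled_eq (288 * Q ^+ 2 * Z) DDR;
  scaled_eq (Z * (P ^+ 2 * Q ^+ 2 * R * (8 * (a + 3 * n) + 9) - 16 * a * P * Q * R ^+ 2
    - 24 * P * Q ^+ 4
    + Q ^+ 3 * R * (e + 4 - 48 * n)) - (e - 30 - 48 * n) * (Q ^+ 3 - R ^+ 2) * Z * R) Ea]).
Qed.

End Monomial.

Lemma kz_op_sum (I : Type) (r : seq I) (c : I -> F) (f : I -> fps F) :
  kz_op (\sum_(i <- r) fps_const (c i) * f i) =
  \sum_(i <- r) fps_const (c i) * kz_op (f i).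
Proof.
elim: r => [|i r IH]; first by rewrite !big_nil /kz_op !raddf0; ring.
by rewrite !big_cons -IH /kz_op !raddfD /= !fpsD_constM; ring.
Qed.

Lemma kz_op_eqmod N f g : fps_eqmod N f g -> fps_eqmod N (kz_op f) (kz_op g).
Proof.
move=> fg; have DE h h' : fps_eqmod N h h' -> fps_eqmod N (D h) (D h').
  by move=> hh i iN; rewrite !fpsEderiv hh.
move=> i iN; rewrite /kz_op !fpsEadd !fpsEopp.
have e k h h' : fps_eqmod N h h' -> fps_eqmod N (k * h) (k * h').
  exact: fps_eqmodM.
by congr (_ - _ + _); apply: e => //; [exact/DE/DE | exact: DE].
Qed.

Lemma fps_triangular (W : nat -> fps F) (c : nat -> F) N :
  (forall m, fps_ord m (W m)) -> (forall m, W m m != 0) ->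
  (forall i, (i < N)%N -> (\sum_(m < N) fps_const (c m) * W m) i = 0) ->
  forall m, (m < N)%N -> c m = 0.
Proof.
move=> Word Wlead H m; elim/ltn_ind: m => m IH mN.
have := H m mN; rewrite fpsEsum (bigD1 (Ordinal mN))// fpsEconst big1.
  rewrite [X in X = _]addr0.
  by move/eqP; rewrite mulf_eq0 (negPf (Wlead m)) orbF => /eqP.
move=> i /eqP im; rewrite fpsEconst; have [lt|ge] := ltnP i m.
  by rewrite IH ?mul0r.
rewrite Word ?mulr0// ltn_neqAle ge andbT; apply/eqP => e.
by apply: im; apply: val_inj.
Qed.

Section Recurrence.
Variables (n a b : nat).
Hypothesis b_le1 : (b <= 1)%N.
Hypotheses (Q0 : Q 0%N = 1) (R0 : R 0%N = 1) (V0 : V 0%N = 0) (V1 : V 1%N != 0).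
Hypothesis half_weight : (2 * (12 * n + 4 * a + 6 * b))%:R = 1 :> F.

Local Notation monomial := (wt_monomial Q R n a b).

Let monomial_ord m : fps_ord m (monomial m) /\ monomial m m = V 1%N ^+ m.
Proof. exact: wt_monomial_ord. Qed.

Let kappa m : F := (24 * m%:R + 12 * b%:R - 1) * (24 * m%:R + 12 * b%:R + 7).
Let lambda m : F := 144 * m%:R * (4 * m%:R - 1).

Lemma kz_op_wt_monomial m : (m <= n)%N ->
  3 * Q ^+ 2 * kz_op (monomial m) =
  fps_const (lambda m) * (Q ^+ 3 * monomial m)
  - fps_const (kappa m) * (V * monomial m).
Proof.
move=> mn; set al := (3 * (n - m) + a)%N.
(* As a natural number the left side is twice the weight; only its image in F is 1. *)
have alE : 8 * al%:R + 24 * m%:R + 12 * b%:R = 1 :> fps F.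
  rewrite -!natrM -!natrD -[RHS](rmorph1 (@fps_const F)) -half_weight rmorph_nat.
  by congr _%:R; rewrite /al; lia.
rewrite /lambda /kappa !(rmorphM, rmorphD, rmorphB, rmorph_nat, rmorph1) /=.
rewrite /wt_monomial -/al -/V; case: b b_le1 alE => [|[|//]] _ alE.
  rewrite expr0 mulr1 kz_op_monomial0; last by lincomb [:: scaled_eq 1 alE].
  by rewrite /V; ring.
rewrite expr1 kz_op_monomial1; last by lincomb [:: scaled_eq 1 alE].
by rewrite /V; ring.
Qed.

(** Since Q^3 times monomial m + 1 equals V times monomial m, the image of the sum is a combination
    of the series V times monomial m, of order m + 1. It vanishes through q^n, so triangularity
    annihilates each coefficient with m < n. *)
Lemma kz_recurrence (th : fps F) (g : nat -> F) : kz_op th = 0 ->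
  fps_eqmod n (\sum_(m < n.+1) fps_const (g m) * monomial m) th ->
  forall m, (m < n)%N ->
    g m.+1 * (144 * m.+1%:R * (4 * m%:R + 3)) =
    g m * ((24 * m%:R + 12 * b%:R - 1) * (24 * m%:R + 12 * b%:R + 7)).
Proof.
move=> th0 gth m mn; apply/eqP; rewrite -subr_eq0; apply/eqP.
pose c m := g m.+1 * (144 * m.+1%:R * (4 * m%:R + 3)) - g m * kappa m.
(* The shift makes [W m] have order exactly m; [W 0] is a placeholder with coefficient 0. *)
pose W m : fps F := if m is m'.+1 then V * monomial m' else 1.
(* The top term has no partner monomial, but its series has order n + 1, beyond the range of
   agreement with [th]. *)
pose d m := if m is m'.+1 then (if (m' < n)%N then c m' else - (g m' * kappa m')) else 0.
suff : forall i, (i < n.+1)%N -> d i = 0 by move=> /(_ m.+1 mn); rewrite /= mn.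
apply: (@fps_triangular W d n.+1).
- move=> [|i]//; have [x1 _] := monomial_ord i.
  have Vord : fps_ord 1 V by case.
  by have [y _] := fps_ordM Vord x1.
- move=> [|i]; first by rewrite /W fpsE1 oner_eq0.
  have [x1 x2] := monomial_ord i; have Vord : fps_ord 1 V by case.
  by have [_ y] := fps_ordM Vord x1; rewrite /W -add1n y x2 mulf_neq0 ?expf_neq0.
have TE : 3 * Q ^+ 2 * kz_op (\sum_(m < n.+1) fps_const (g m) * monomial m) =
  \sum_(m < n.+2) fps_const (d m) * W m.
  rewrite kz_op_sum mulr_sumr [RHS]big_ord_recl /= rmorph0 mul0r add0r.
  transitivity (\sum_(i < n.+1) fps_const (g i * lambda i) * (Q ^+ 3 * monomial i)
    - \sum_(i < n.+1) fps_const (g i * kappa i) * (V * monomial i)).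
    rewrite -sumrB; apply: eq_bigr => i _.
    rewrite mulrCA kz_op_wt_monomial; last exact: ltn_ord i.
    move: (lambda i) (kappa i) (monomial i) => l k X.
    by rewrite mulrBr !mulrA !(rmorphM (@fps_const F)).
  rewrite big_ord_recl [X in _ - X]big_ord_recr /= [RHS]big_ord_recr /= ltnn rmorphN.
  rewrite /lambda mulr0 mul0r mulr0 rmorph0 mul0r add0r opprD addrA -sumrB mulNr.
  congr (_ - _); apply: eq_bigr => i _; rewrite ltn_ord /c rmorphB.
  rewrite (mulrBl (V * monomial i)) add0n; congr (_ * _ - _).
    by congr fps_const; rewrite /bump /= -natr1; ring.
  rewrite /wt_monomial -/V /bump /= add1n [V ^+ i.+1]exprS.
  have -> : (3 * (n - i) + a = 3 + (3 * (n - i.+1) + a))%N by have := ltn_ord i; lia.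
  by rewrite (exprD Q 3); move: V (V ^+ i) => v vi; ring.
move=> i iN.
have E0 : (\sum_(m < n.+2) fps_const (d m) * W m) i = 0.
  rewrite -TE.
  have e := @fps_eqmodM _ n (3 * Q ^+ 2) _ _ _ (fun _ _ => erefl _) (kz_op_eqmod gth).
  by rewrite e// th0 mulr0 fpsE0.
move: E0; rewrite big_ord_recr fpsEadd [X in _ + X]fpsEconst.
have Vord : fps_ord 1 V by case.
have [x1 _] := monomial_ord n; have [y _] := fps_ordM Vord x1.
by rewrite (_ : W _ i = 0) ?mulr0 ?addr0//; apply: y.
Qed.

End Recurrence.
End KanekoZagier.

(** * Asymptotic expansions and q-expansions *)

Section Asymptotics.
Local Open Scope classical_set_scope.
Variable R : realType.
Implicit Types (f g : R -> R) (a b : fps R).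

(* f(x) = sum_(m <= N) a_m x^m + O(x^(N+1)) as x -> 0+.  The higher coefficients
   of p are left free so that p can be multiplied without truncation. *)
Definition asymp (N : nat) f a := exists (p : {poly R}) (M d : R),
  [/\ 0 < d, d <= 1, 0 <= M, forall i, (i <= N)%N -> p`_i = a i &
      forall x, 0 < x -> x < d -> `|f x - p.[x]| <= M * x ^+ N.+1].

Lemma poly_bounded (p : {poly R}) :
  exists2 B, 0 <= B & forall x, 0 < x -> x <= 1 -> `|p.[x]| <= B.
Proof.
exists (\sum_(i < size p) `|p`_i|); first exact: sumr_ge0.
move=> x x0 x1; rewrite horner_coef (le_trans (ler_norm_sum _ _ _))//.
apply: ler_sum => i _; rewrite normrM ler_piMr// normrX (ger0_norm (ltW x0)).
by rewrite exprn_ile1// ltW.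
Qed.

Lemma asymp_ext N f g a : (exists2 d, 0 < d & forall x, 0 < x -> x < d -> f x = g x) ->
  asymp N f a -> asymp N g a.
Proof.
move=> [d' d'0 fg] [p [M [d [d0 d1 M0 pa H]]]].
exists p, M, (Num.min d d'); split=> //.
- by rewrite lt_min d0.
- by rewrite ge_min d1.
- by move=> x x0; rewrite lt_min => /andP[xd xd']; rewrite -fg// H.
Qed.

Lemma asymp_const N c : asymp N (fun=> c) (fps_const c).
Proof.
exists c%:P, 0, 1; split=> // [i _|x _ _]; first by rewrite coefC.
by rewrite hornerC subrr normr0 mul0r.
Qed.

Lemma asympD N f g a b : asymp N f a -> asymp N g b -> asymp N (fun x => f x + g x) (a + b).
Proof.
move=> [p [M [d [d0 d1 M0 pa H]]]] [q [M' [d' [d'0 d'1 M'0 qb H']]]].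
exists (p + q), (M + M'), (Num.min d d'); split=> //.
- by rewrite lt_min d0.
- by rewrite ge_min d1.
- exact: addr_ge0.
- by move=> i iN; rewrite coefD pa// qb.
- move=> x x0; rewrite lt_min => /andP[xd xd']; rewrite hornerD mulrDl.
  have -> : f x + g x - (p.[x] + q.[x]) = (f x - p.[x]) + (g x - q.[x]) by ring.
  by rewrite (le_trans (ler_normD _ _))// lerD// ?H// H'.
Qed.

Lemma asympM N f g a b : asymp N f a -> asymp N g b -> asymp N (fun x => f x * g x) (a * b).
Proof.
move=> [p [M [d [d0 d1 M0 pa H]]]] [q [M' [d' [d'0 d'1 M'0 qb H']]]].
have [A A0 pA] := poly_bounded p; have [B B0 qB] := poly_bounded q.
exists (p * q), (M * (M' + B) + A * M'), (Num.min d d'); split=> //.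
- by rewrite lt_min d0.
- by rewrite ge_min d1.
- by rewrite addr_ge0 ?mulr_ge0 ?addr_ge0.
- move=> i iN; rewrite coefM fpsEmul; apply: eq_bigr => j _.
  by rewrite pa ?qb// ?(leq_trans (leq_subr _ _))// (leq_trans _ iN)// -ltnS.
- move=> x x0; rewrite lt_min => /andP[xd xd']; rewrite hornerM.
  have x1 : x <= 1 by lra.
  have -> : f x * g x - p.[x] * q.[x] =
    (f x - p.[x]) * ((g x - q.[x]) + q.[x]) + p.[x] * (g x - q.[x]) by ring.
  have xN : 0 <= x ^+ N.+1 by rewrite exprn_ge0// ltW.
  have xN1 : x ^+ N.+1 <= 1 by rewrite exprn_ile1// ltW.
  rewrite (le_trans (ler_normD _ _))// [leRHS]mulrDl lerD// normrM.
    rewrite [leRHS]mulrAC ler_pM ?H//.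
    rewrite (le_trans (ler_normD _ _))// lerD ?qB//.
    by rewrite (le_trans (H' _ _ _))// ler_piMr.
  by rewrite -mulrA ler_pM// ?pA// H'.
Qed.

Lemma asympX N f a k : asymp N f a -> asymp N (fun x => f x ^+ k) (a ^+ k).
Proof.
move=> fa; elim: k => [|k IH].
  under [X in asymp _ X _]eq_fun do rewrite expr0.
  by rewrite expr0; apply: asymp_const.
under [X in asymp _ X _]eq_fun do rewrite exprS.
by rewrite exprS; apply: asympM.
Qed.

Lemma asymp_sum N k (f : nat -> R -> R) (a : nat -> fps R) :
  (forall i, (i < k)%N -> asymp N (f i) (a i)) ->
  asymp N (fun x => \sum_(i < k) f i x) (\sum_(i < k) a i).
Proof.
elim: k => [|k IH] H.
  under [X in asymp _ X _]eq_fun do rewrite big_ord0.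
  by rewrite big_ord0 -(rmorph0 (@fps_const R)); apply: asymp_const.
under [X in asymp _ X _]eq_fun do rewrite big_ord_recr.
rewrite big_ord_recr; apply: asympD; last exact: H.
by apply: IH => i ik; apply: H; apply: ltnW.
Qed.

Lemma asymp_lead N f a : asymp N f a -> fps_ord N a ->
  exists K d, [/\ 0 < d, 0 <= K &
    forall x, 0 < x -> x < d -> `|f x - a N * x ^+ N| <= K * x ^+ N.+1].
Proof.
move=> [p [M [d [d0 d1 M0 pa H]]]] aN.
pose q := drop_poly N.+1 p.
have pE : p = (a N)%:P * 'X^N + q * 'X^(N.+1).
  rewrite -[LHS](poly_take_drop N.+1); congr (_ + _).
  apply/polyP => i; rewrite coef_take_poly coefCM coefXn ltnS leq_eqVlt.
  have [->|iN] := eqVneq i N; first by rewrite pa// mulr1.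
  by rewrite mulr0; case: ltnP => //= iN'; rewrite pa ?aN// ltnW.
have [B B0 qB] := poly_bounded q.
exists (M + B), d; split=> //; first exact: addr_ge0.
move=> x x0 xd; have := H x x0 xd.
have qx := qB x x0 (ltW (lt_le_trans xd d1)).
rewrite {1}pE hornerD !hornerM hornerC !hornerXn => Hx.
have -> : f x - a N * x ^+ N =
  (f x - (a N * x ^+ N + q.[x] * x ^+ N.+1)) + q.[x] * x ^+ N.+1 by ring.
rewrite (le_trans (ler_normD _ _))// mulrDl lerD// normrM.
by rewrite ler_pM// ger0_norm// exprn_ge0// ltW.
Qed.

Lemma asymp_neq0 N f a : asymp N f a -> fps_ord N a -> a N != 0 ->
  exists2 d, 0 < d & forall x, 0 < x -> x < d -> f x != 0.
Proof.
move=> fa aN an0; have [K [d [d0 K0 H]]] := asymp_lead fa aN.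
have c0 : 0 < `|a N| by rewrite normr_gt0.
exists (Num.min d (`|a N| / (K + 1))).
  by rewrite lt_min d0 divr_gt0// ltr_wpDl.
move=> x x0; rewrite lt_min => /andP[xd xK]; apply/eqP => fx0.
have := H x x0 xd; rewrite fx0 sub0r normrN normrM (gtr0_norm (exprn_gt0 N x0)).
rewrite exprS mulrA ler_pM2r ?exprn_gt0//; apply/negP; rewrite -ltNge.
rewrite ltr_pdivlMr ?ltr_wpDl// in xK.
by rewrite (le_lt_trans _ xK)// mulrC ler_wpM2l// ?lerDl// ltW.
Qed.

(** Uniqueness of expansions: a first nonzero coefficient would make f nonzero near 0. *)
Lemma asymp_eq0 N f a : asymp N f a ->
  (exists2 d, 0 < d & forall x, 0 < x -> x < d -> f x = 0) ->
  forall i, (i <= N)%N -> a i = 0.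
Proof.
move=> [p [M [d [d0 d1 M0 pa H]]]] [d' d'0 f0] i.
elim/ltn_ind: i => i IH iN; apply/eqP; apply: contraT => ai.
have fa : asymp i f a.
  exists p, M, d; split=> // [j ji|x x0 xd]; first by rewrite pa// (leq_trans ji).
  rewrite (le_trans (H x x0 xd))// ler_wpM2l// -(subnK iN) -addnS exprD ler_piMl//.
    by rewrite exprn_ge0// ltW.
  by rewrite exprn_ile1// ltW// (lt_le_trans xd).
have ord : fps_ord i a by move=> j ji; rewrite IH// (leq_trans (ltnW ji)).
have [e e0 fn0] := asymp_neq0 fa ord ai.
have x0 : 0 < Num.min e d' / 2 by rewrite divr_gt0// lt_min e0.
have xlt : Num.min e d' / 2 < Num.min e d'.
  by rewrite ltr_pdivrMr// mulr_natr mulr2n ltrDl lt_min e0.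
have := xlt; rewrite lt_min => /andP[x1 x2].
by have := fn0 _ x0 x1; rewrite f0// eqxx.
Qed.

Lemma sum_geo_half (y : R) k : 0 <= y -> y <= 1 / 2 -> \sum_(i < k) y ^+ i <= 2.
Proof.
move=> y0 y1; have := subrX1 y k; have : 0 <= y ^+ k by apply: exprn_ge0.
set S := \sum_(i < k) _ => yk E.
have : 0 <= S by apply: sumr_ge0 => i _; apply: exprn_ge0.
nra.
Qed.

(** Pointwise convergence is all that a q-expansion provides. Convergence at r/2 bounds a_n (r/2)^n,
    and for x < r/4 the tail is then dominated by a geometric series of ratio at most 1/2. *)
Lemma asymp_series N f (a : fps R) (r : R) : 0 < r ->
  (forall x, 0 < x -> x < r -> series (fun n => a n * x ^+ n) @ \oo --> f x) ->
  asymp N f a.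
Proof.
move=> r0 H; have r2 : 0 < r / 2 by lra.
have [B B0 aB] : exists2 B, 0 <= B & forall n, `|a n * (r / 2) ^+ n| <= B.
  have /cvgP/cvg_series_bounded[M [Mr MB]] := H _ r2 ltac:(lra).
  exists (Num.max (M + 1) 0); first by rewrite le_max lexx orbT.
  move=> n; rewrite le_max; apply/orP; left; apply: MB => //.
  by rewrite ltrDl.
have r4 : 0 < r / 4 by lra.
exists (fps_trunc N.+1 a), (B * 2 / (r / 2) ^+ N.+1), (Num.min 1 (r / 4)).
split=> //.
- by rewrite lt_min ltr01.
- by rewrite ge_min lexx.
- by rewrite divr_ge0// ?mulr_ge0// exprn_ge0// ltW.
- by move=> i iN; rewrite coef_trunc.
move=> x x0; rewrite lt_min => /andP[_ xr].
have Hx := H x x0 ltac:(lra).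
rewrite horner_poly; set c := \sum_(i < _) _.
pose y := x / (r / 2).
have y0 : 0 <= y by rewrite divr_ge0// ltW.
have y1 : y <= 1 / 2 by rewrite ler_pdivrMr//; lra.
have term m : `|a m * x ^+ m| <= B * y ^+ m.
  have -> : a m * x ^+ m = a m * (r / 2) ^+ m * y ^+ m.
    by rewrite -mulrA -exprMn /y mulrC mulrC [r / 2 * _]mulrC divfK// gt_eqF.
  by rewrite normrM ler_pM// ger0_norm// exprn_ge0.
have Hc : (fun n => `|series (fun n => a n * x ^+ n) n - c|) @ \oo --> `|f x - c|.
  by apply: cvg_norm; apply: cvgB => //; exact: cvg_cst.
rewrite -(cvg_lim _ Hc)//; apply: limr_le; first exact: cvgP Hc.
exists N.+1 => // n /= Nn.
rewrite /series /= (big_cat_nat (leq0n N.+1) Nn) /c big_mkord addrC addKr.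
rewrite -{1}[N.+1]add0n big_addn big_mkord (le_trans (ler_norm_sum _ _ _))//.
apply: (@le_trans _ _ (\sum_(i < n - N.+1) B * y ^+ N.+1 * y ^+ i)).
  by apply: ler_sum => i _; rewrite -mulrA -exprD addnC term.
rewrite -mulr_sumr (le_trans (ler_wpM2l _ (sum_geo_half _ y0 y1)))//.
  by rewrite mulr_ge0// exprn_ge0.
by rewrite /y exprMn exprVn; lra.
Qed.

End Asymptotics.

(** * Restriction to the imaginary axis *)

Section ImaginaryAxis.
Local Open Scope classical_set_scope.
Variable R : realType.
Local Notation C := R[i].
Local Open Scope complex_scope.

Lemma nome_imaginary_axis (x : R) : 0 < x -> x < 1 ->
  exists2 t : C, upper_half t & nome t = x%:C.
Proof.
move=> x0 x1; exists (0 +i* (- ln x / (2 * pi))).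
  by rewrite /upper_half /= divr_gt0 ?mulr_gt0 ?pi_gt0// oppr_gt0 ln_lt0// x0.
have p0 : 2 * pi != 0 :> R by rewrite gt_eqF// mulr_gt0 ?pi_gt0.
have -> : nome (0 +i* (- ln x / (2 * pi))) = cexp ((ln x)%:C).
  rewrite /nome; congr cexp; simpc.
  by rewrite mulrC divfK.
rewrite /cexp /= lnK ?posrE// cos0 sin0.
by simpc.
Qed.

Lemma cvg_complex_Re (u : nat -> C) (l : C) : (u : nat -> C^o) @ \oo --> (l : C^o) ->
  (fun n => complex.Re (u n)) @ \oo --> complex.Re l.
Proof.
move=> /cvgrPdist_lt H; apply/cvgrPdist_lt => e e0.
have eC : 0 < e%:C by rewrite ltcR.
have := H _ eC; apply: filterS => n.
rewrite -ltcR; apply: le_lt_trans.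
by rewrite -raddfB; apply: normc_ge_Re.
Qed.

Lemma cvg_real_complex (u : nat -> R) (l : R) : u @ \oo --> l ->
  (fun n => (u n)%:C : C^o) @ \oo --> (l%:C : C^o).
Proof.
move=> /cvgrPdist_lt H; apply/cvgrPdist_lt => e e0.
have [r r0 rE] : exists2 r : R, 0 < r & e = r%:C.
  by case: e e0 => er ei; rewrite ltcE /= => /andP[/eqP-> ?]; exists er.
have := H _ r0; apply: filterS => n; rewrite rE.
have -> : l%:C - (u n)%:C = (l - u n)%:C by rewrite rmorphB.
by rewrite normc_def /= expr0n addr0 sqrtr_sqr ltcR.
Qed.

Lemma qseries_real (a : nat -> R) (t : C) (x : R) : nome t = x%:C ->
  qseries (fun n => (a n)%:C) t = (fun n => (series (fun n => a n * x ^+ n) n)%:C).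
Proof.
move=> tx; apply/funext => n; rewrite /qseries /series /= rmorph_sum.
by apply: eq_bigr => i _; rewrite tx rmorphM rmorphXn.
Qed.

Lemma qseries_Re (a : nat -> C) (t : C) (x : R) n : nome t = x%:C ->
  complex.Re (qseries a t n) = series (fun n => complex.Re (a n) * x ^+ n) n.
Proof.
move=> tx; rewrite /qseries /series /= raddf_sum; apply: eq_bigr => i _.
by rewrite tx -rmorphXn; case: (a i) => p q /=; rewrite mulr0 subr0.
Qed.

(** The coefficients may be complex, but the nome is real along h, so real parts can be taken
    termwise. *)
Lemma has_qexp_Re_asymp (f : C -> C) (a : nat -> C) (h : R -> C) N :
  has_qexp f a ->
  (forall x, 0 < x -> x < 1 -> upper_half (h x) /\ nome (h x) = x%:C) ->
  asymp N (fun x => complex.Re (f (h x))) (Fps (fun n => complex.Re (a n))).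
Proof.
move=> fa hx; apply: (@asymp_series _ _ _ _ 1) => // x x0 x1.
have [ht hn] := hx x x0 x1.
have := cvg_complex_Re (fa _ ht).
by under eq_fun do rewrite (qseries_Re _ _ hn).
Qed.

Lemma is_cvg_pseries (a : nat -> R) (c r : R) (x : R) :
  (forall n, `|a n| <= c * r ^+ n) -> 0 <= r -> 0 < x -> r * x < 1 ->
  cvg (series (fun n => a n * x ^+ n) @ \oo).
Proof.
move=> ac r0 x0 rx.
have le n : `|a n * x ^+ n| <= geometric c (r * x) n.
  have xn := exprn_gt0 n x0.
  by rewrite /geometric /= normrM exprMn mulrA (gtr0_norm xn) ler_wpM2r// ltW.
apply: (@normed_cvg R R^o).
apply: (@series_le_cvg _ _ (geometric c (r * x))).
- by move=> n; exact: normr_ge0.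
- by move=> n; apply: le_trans (le n).
- exact: le.
by apply: is_cvg_geometric_series; rewrite ger0_norm// mulr_ge0// ltW.
Qed.

(** A crude exponential bound suffices: some positive radius of convergence is enough for the limit
    q -> 0+. *)
Lemma sigma_le e n : (sigma e n <= (2 ^ e.+1) ^ n)%N.
Proof.
rewrite /sigma; have [->|n0] := posnP n; first by rewrite big_seq1 exp1n.
have H d : d \in divisors n -> (d <= n)%N.
  by rewrite -dvdn_divisors// => /dvdn_leq->.
apply: (@leq_trans (\sum_(d <- divisors n) (2 ^ n) ^ e)).
  rewrite big_seq [leqRHS]big_seq; apply: leq_sum => d /H dn.
  have [->|e0] := posnP e; first by rewrite !expn0.
  by rewrite leq_exp2r// (leq_trans dn)// ltnW// ltn_expl.
rewrite big_const_seq count_predT iter_addn_0 mulnC.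
rewrite -!expnM (mulnC e.+1) mulnS expnD expnM -expnM leq_mul2r; apply/orP; right.
rewrite (leq_trans _ (ltn_expl n (isT : 1 < 2)%N))//.
have -> : n.+1 = size (iota 0 n.+1) by rewrite size_iota.
apply: uniq_leq_size; first exact: divisors_uniq.
by move=> d /H dn; rewrite mem_iota.
Qed.
End ImaginaryAxis.

(** * Eisenstein coefficients in weights 4 and 6 *)

Lemma bernoulliS m : bernoulli m.+1 =
  - (\sum_(i < m.+1) 'C(m.+2, i)%:R * bernoulli i) / m.+2%:R.
Proof.
have := bernoulli_sum m.+1; rewrite big_ord_recr /= binSn => /eqP.
rewrite addr_eq0 => /eqP E; rewrite E opprK mulrC mulKf//.
by rewrite pnatr_eq0.
Qed.

Lemma bernoulli_values : bernoulli 4 = - 1 / 30%:R /\ bernoulli 6 = 1 / 42%:R.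
Proof.
have b0 : bernoulli 0 = 1.
  by have := bernoulli_sum 0; rewrite big_ord1 bin0 mul1r.
have b1 : bernoulli 1 = - 1 / 2.
  by rewrite bernoulliS !big_ord_recr big_ord0 /= b0 /binomial /=; field.
have b2 : bernoulli 2 = 1 / 6.
  by rewrite bernoulliS !big_ord_recr big_ord0 /= b0 b1 /binomial /=; field.
have b3 : bernoulli 3 = 0.
  by rewrite bernoulliS !big_ord_recr big_ord0 /= b0 b1 b2 /binomial /=; field.
have b4 : bernoulli 4 = - 1 / 30.
  by rewrite bernoulliS !big_ord_recr big_ord0 /= b0 b1 b2 b3 /binomial /=; field.
have b5 : bernoulli 5 = 0.
  by rewrite bernoulliS !big_ord_recr big_ord0 /= b0 b1 b2 b3 b4 /binomial /=; field.
split; first exact: b4.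
by rewrite bernoulliS !big_ord_recr big_ord0 /= b0 b1 b2 b3 b4 b5 /binomial /=; field.
Qed.

Lemma eisenstein_coef4 n : eisenstein_coef 4 n = (E4_ser n)%:~R.
Proof.
rewrite /eisenstein_coef /E4_ser fpsEadd fpsE1 fpsEnat /= (proj1 bernoulli_values).
case: eqP => // _; rewrite add0r rmorphM /=.
by congr (_ * _); field.
Qed.

Lemma eisenstein_coef6 n : eisenstein_coef 6 n = (E6_ser n)%:~R.
Proof.
rewrite /eisenstein_coef /E6_ser fpsEsub fpsE1 fpsEnat /= (proj2 bernoulli_values).
case: eqP => // _; rewrite sub0r rmorphN rmorphM /= -mulNr.
by congr (_ * _); field.
Qed.

Lemma E4_ser0 : E4_ser 0%N = 1.
Proof. by rewrite /E4_ser fpsEadd fpsEnat fpsE1 /= mulr0 addr0. Qed.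

Lemma E6_ser0 : E6_ser 0%N = 1.
Proof. by rewrite /E6_ser fpsEsub fpsEnat fpsE1 /= mulr0 subr0. Qed.

Lemma fps_coef1M (S : comNzRingType) (f g : fps S) :
  (f * g) 1%N = f 0%N * g 1%N + f 1%N * g 0%N.
Proof. by rewrite fpsEmul !big_ord_recr big_ord0 /= add0r. Qed.

Lemma fps_coef0M (S : comNzRingType) (f g : fps S) : (f * g) 0%N = f 0%N * g 0%N.
Proof. by rewrite fpsEmul big_ord1. Qed.

Definition disc_ser : fps int := E4_ser ^+ 3 - E6_ser ^+ 2.

Lemma disc_ser0 : disc_ser 0%N = 0.
Proof.
by rewrite /disc_ser fpsEsub !exprS expr0 !mulr1 !fps_coef0M E4_ser0 E6_ser0.
Qed.

Lemma disc_ser1 : disc_ser 1%N = 1728%:Z.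
Proof.
rewrite /disc_ser fpsEsub !exprS expr0 !mulr1 !fps_coef1M !fps_coef0M E4_ser0 E6_ser0.
rewrite /E4_ser /E6_ser fpsEadd fpsEsub !fpsEnat !fpsE1 /= /sigma !big_seq1 !exp1n.
by [].
Qed.

Section QExpansion.
Local Open Scope classical_set_scope.
Variable R : realType.
Local Notation C := R[i].
Local Open Scope complex_scope.

Definition eis_real (k : nat) (x : R) : R :=
  lim (series (fun n => ratr (eisenstein_coef k n) * x ^+ n) @ \oo).

Lemma eis_bound (k : nat) (c : R) n : (0 < k)%N ->
  (forall n, n != 0%N -> `|ratr (eisenstein_coef k n) : R| <= c * (sigma k.-1 n)%:R) ->
  1 <= c -> `|ratr (eisenstein_coef k n) : R| <= c * (2 ^+ k) ^+ n.
Proof.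
move=> k0 H c1; have [->|n0] := eqVneq n 0%N.
  by rewrite /eisenstein_coef /= rmorph1 normr1 expr0 mulr1.
rewrite (le_trans (H n n0))// ler_wpM2l//; first by apply: le_trans c1.
by rewrite -!natrX ler_nat -{2}(prednK k0) sigma_le.
Qed.

Lemma eis4_bound n : `|ratr (eisenstein_coef 4 n) : R| <= 240 * (2 ^+ 4) ^+ n.
Proof.
apply: eis_bound => [|m m0|] //; last by rewrite ler1n.
rewrite eisenstein_coef4 ratr_int /E4_ser fpsEadd fpsE1 fpsEnat /= (negPf m0) add0r.
by rewrite rmorphM /= normrM !ger0_norm// ler0n.
Qed.

Lemma eis6_bound n : `|ratr (eisenstein_coef 6 n) : R| <= 504 * (2 ^+ 6) ^+ n.
Proof.
apply: eis_bound => [|m m0|] //; last by rewrite ler1n.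
rewrite eisenstein_coef6 ratr_int /E6_ser fpsEsub fpsE1 fpsEnat /= (negPf m0) sub0r.
by rewrite rmorphN normrN rmorphM /= normrM !ger0_norm// ler0n.
Qed.

Lemma eisenstein_real k (c r x : R) (t : C) :
  (forall n, `|ratr (eisenstein_coef k n) : R| <= c * r ^+ n) -> 0 <= r ->
  0 < x -> r * x < 1 -> nome t = x%:C -> eisenstein k t = (eis_real k x)%:C.
Proof.
move=> H r0 x0 rx tx.
have cv := is_cvg_pseries H r0 x0 rx.
have ra n : ratr (eisenstein_coef k n) = (ratr (eisenstein_coef k n))%:C :> C.
  by rewrite -(fmorph_rat (real_complex R)).
rewrite /eisenstein; under eq_fun do rewrite ra.
rewrite (qseries_real _ tx); apply: (@cvg_lim (R[i] : numFieldType)^o); first exact: norm_hausdorff.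
exact: cvg_real_complex cv.
Qed.

Lemma eis_real_asymp k (c r : R) (E : fps int) N :
  (forall n, `|ratr (eisenstein_coef k n) : R| <= c * r ^+ n) -> 0 < r ->
  (forall n, eisenstein_coef k n = (E n)%:~R) ->
  asymp N (eis_real k) (fps_map (intmul 1) E).
Proof.
move=> H r0 kE; apply: (@asymp_series _ _ _ _ (r^-1)); first by rewrite invr_gt0.
move=> x x0 xr; have rx : r * x < 1 by rewrite mulrC -ltr_pdivlMr// div1r.
have cv := is_cvg_pseries H (ltW r0) x0 rx.
rewrite /eis_real.
have -> : (fun n => fps_map (intmul 1) E n * x ^+ n) =
   (fun n => ratr (eisenstein_coef k n) * x ^+ n).
  by apply/funext => n; rewrite kE ratr_int fpsEmap.
exact: cv.
Qed.

End QExpansion.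

Lemma fps_map_monomial (S T : comNzRingType) (phi : {rmorphism S -> T})
    (Q P : fps S) n a b m :
  fps_map phi (wt_monomial Q P n a b m) =
  wt_monomial (fps_map phi Q) (fps_map phi P) n a b m.
Proof. by rewrite /wt_monomial !rmorphM !rmorphXn rmorphB !rmorphXn. Qed.

(* P[f](j) times Delta^n E4^a E6^b, with j = 1728 x^3 / d and Delta = d / 1728. *)
Lemma jpoly_expand (K : fieldType) (p : {poly K}) (n a b : nat) (x y d c : K) :
  (size p <= n.+1)%N -> d != 0 -> c != 0 ->
  (d / c) ^+ n * x ^+ a * y ^+ b * p.[x ^+ 3 / (d / c)] =
  \sum_(m < n.+1) p`_(n - m) / c ^+ m * (x ^+ (3 * (n - m) + a) * d ^+ m * y ^+ b).
Proof.
move=> pn d0 c0; rewrite (horner_coef_wide _ pn) mulr_sumr.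
rewrite (reindex_inj rev_ord_inj) /=; apply: eq_bigr => m _; rewrite subSS.
have mn : (m <= n)%N by rewrite -ltnS.
have -> : (d / c) ^+ n = (d / c) ^+ (n - m) * (d / c) ^+ m by rewrite -exprD subnK.
rewrite exprD exprM ![(_ / _) ^+ _]exprMn !exprVn ![(_ / _) ^+ _]exprMn !exprVn.
have dm : d ^+ (n - m) != 0 by rewrite expf_neq0.
have cm : c ^+ (n - m) != 0 by rewrite expf_neq0.
have cm' : c ^+ m != 0 by rewrite expf_neq0.
by field; rewrite ?dm ?cm ?cm'.
Qed.

(** * From P[f] to identities between q-coefficients *)

Section Bridge.
Local Open Scope classical_set_scope.
Variables (R : realType) (k : nat) (g : R[i] -> R[i]) (P : {poly rat}).
Local Notation C := R[i].
Local Open Scope complex_scope.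
Let n := wt_n k.
Let a := wt_a k.
Let b := wt_b k.

Hypothesis g_def : is_modular_truncation k (fun n => (theta_coef n)%:R) g.
Hypothesis P_def : is_jpoly k g P.

Let e4 := @eis_real R 4.
Let e6 := @eis_real R 6.
Let d46 x := e4 x ^+ 3 - e6 x ^+ 2.
Let E4 : fps R := fps_map (intmul 1) E4_ser.
Let E6 : fps R := fps_map (intmul 1) E6_ser.

Let e4_asymp N : asymp N e4 E4.
Proof. by apply: (eis_real_asymp _ (@eis4_bound R) _ eisenstein_coef4); rewrite exprn_gt0. Qed.

Let e6_asymp N : asymp N e6 E6.
Proof. by apply: (eis_real_asymp _ (@eis6_bound R) _ eisenstein_coef6); rewrite exprn_gt0. Qed.

Let d46_asymp N : asymp N d46 (E4 ^+ 3 - E6 ^+ 2).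
Proof.
have := asympD (asympX 3 (@e4_asymp N))
  (asympM (asymp_const N (-1)) (asympX 2 (@e6_asymp N))).
rewrite rmorphN1 mulN1r; apply: asymp_ext.
by exists 1 => // x _ _; rewrite mulN1r.
Qed.

Let e4_neq0 : exists2 d, 0 < d & forall x, 0 < x -> x < d -> e4 x != 0.
Proof.
apply: (asymp_neq0 (@e4_asymp 0) (fps_ord0 _)).
by rewrite /E4 fpsEmap E4_ser0 oner_eq0.
Qed.

Let e6_neq0 : exists2 d, 0 < d & forall x, 0 < x -> x < d -> e6 x != 0.
Proof.
apply: (asymp_neq0 (@e6_asymp 0) (fps_ord0 _)).
by rewrite /E6 fpsEmap E6_ser0 oner_eq0.
Qed.

Let d46_neq0 : exists2 d, 0 < d & forall x, 0 < x -> x < d -> d46 x != 0.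
Proof.
have dE : E4 ^+ 3 - E6 ^+ 2 = fps_map (intmul 1) disc_ser.
  by rewrite /disc_ser rmorphB !rmorphXn.
apply: (asymp_neq0 (@d46_asymp 1)); rewrite dE.
  by move=> [|//] _; rewrite fpsEmap disc_ser0.
by rewrite fpsEmap disc_ser1 intr_eq0.
Qed.

(** Delta^n j^(n-m) = E4^(3(n-m)) Delta^m, whence the reversed index; 1728^m comes from writing
    Delta as (E4^3 - E6^2) / 1728. *)
Let coefP m : rat := P`_(n - m) / 1728%:R ^+ m.

Let F x := \sum_(m < n.+1) ratr (coefP m) *
  (e4 x ^+ (3 * (n - m) + a) * d46 x ^+ m * e6 x ^+ b).

Let F_asymp N : asymp N F (\sum_(m < n.+1) fps_const (ratr (coefP m))
  * wt_monomial E4 E6 n a b m).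
Proof.
apply: (@asymp_sum _ _ _ (fun m x => ratr (coefP m) *
  (e4 x ^+ (3 * (n - m) + a) * d46 x ^+ m * e6 x ^+ b))
  (fun m => fps_const (ratr (coefP m)) * wt_monomial E4 E6 n a b m)) => m _.
apply: asympM; first exact: asymp_const.
by do ?apply: asympM; exact: asympX.
Qed.

(** The bound on x ensures convergence of both Eisenstein series, and the three nonvanishing
    conditions make the denominator in [is_jpoly] nonzero. *)
Let F_spec x (t : C) : 0 < x -> 2 ^+ 6 * x < 1 -> upper_half t -> nome t = x%:C ->
  e4 x != 0 -> e6 x != 0 -> d46 x != 0 -> complex.Re (g t) = F x.
Proof.
move=> x0 xs ut tx e40 e60 d0; have [_ sP gP] := P_def.
have E4t : eisenstein 4 t = (e4 x)%:C.
  apply: (eisenstein_real (@eis4_bound R) _ x0 _ tx); first by rewrite exprn_ge0.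
  by apply: le_lt_trans xs; rewrite ler_pM2r// -!natrX ler_nat.
have E6t : eisenstein 6 t = (e6 x)%:C.
  by apply: (eisenstein_real (@eis6_bound R) _ x0 xs tx); rewrite exprn_ge0.
have c0 : (1728%:R : R) != 0 by rewrite pnatr_eq0.
have Dt : modular_disc t = (d46 x / 1728%:R)%:C.
  by rewrite /modular_disc E4t E6t rmorphM fmorphV rmorph_nat rmorphB !rmorphXn.
have jt : jinv t = (e4 x ^+ 3 / (d46 x / 1728%:R))%:C.
  by rewrite /jinv Dt E4t -(rmorphXn (real_complex R)) -fmorphV -rmorphM.
have := gP t ut; rewrite -/n -/a -/b Dt E4t E6t jt.
rewrite -!rmorphXn -!rmorphM => /= H; rewrite fmorph_eq0 in H.
have Dn0 : (d46 x / 1728%:R) ^+ n * e4 x ^+ a * e6 x ^+ b != 0.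
  by rewrite !mulf_neq0 ?expf_neq0// mulf_neq0// invr_eq0.
have := H Dn0 => {}H.
have PE : map_poly ratr P = map_poly (real_complex R) (map_poly ratr P).
  by rewrite -map_poly_comp; apply: eq_map_poly => q /=; rewrite fmorph_rat.
move: H; rewrite PE horner_map /= => /(canRL (divfK _)) ->; last by rewrite fmorph_eq0.
rewrite -rmorphM /= mulrC jpoly_expand//; last by rewrite size_map_poly.
apply: eq_bigr => m _; rewrite coef_map /= /coefP; congr (_ * _).
by rewrite rmorphM fmorphV rmorphXn rmorph_nat.
Qed.

(** F and Re g coincide for small q > 0, so their asymptotic coefficients agree; up to q^n those of
    g are the theta coefficients. Injectivity of [ratr] brings the identity back to the
    rationals. *)
Lemma jpoly_theta_rat l : (l <= n)%N ->
  \sum_(m < n.+1) coefP m * (wt_monomial E4_ser E6_ser n a b m l)%:~R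
  = (theta_coef l)%:R.
Proof.
move=> ln; have [_ [ag agP agE]] := g_def.
(* A point with nome x for each x in (0, 1); the value 0 elsewhere is a default. *)
have /choice[h hP] : forall x : R, exists t : C, 0 < x /\ x < 1 ->
    upper_half t /\ nome t = x%:C.
  move=> x; have [[x0 x1]|nx] := pselect (0 < x /\ x < 1); last by exists 0.
  by have [t ut tx] := nome_imaginary_axis x0 x1; exists t.
have gA := has_qexp_Re_asymp n agP (fun x x0 x1 => hP x (conj x0 x1)).
have dA := asympD (@F_asymp n) (asympM (asymp_const n (-1)) gA).
have [d1 d10 h1] := e4_neq0; have [d2 d20 h2] := e6_neq0.
have [d3 d30 h3] := d46_neq0.
have zero : exists2 d : R, 0 < d & forall x, 0 < x -> x < d ->
    F x + -1 * complex.Re (g (h x)) = 0.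
  exists (Num.min (Num.min d1 d2) (Num.min d3 (2 ^+ 6)^-1)).
    by rewrite !lt_min d10 d20 d30 invr_gt0 exprn_gt0.
  move=> x x0; rewrite !lt_min => /andP[/andP[x1 x2] /andP[x3 x4]].
  have p6 : (0 : R) < 2 ^+ 6 by rewrite exprn_gt0.
  have xs : 2 ^+ 6 * x < 1 by rewrite mulrC -ltr_pdivlMr// div1r.
  have xlt1 : x < 1.
    by rewrite (lt_trans x4)// invf_lt1// exprn_egt1// ltr1n.
  have [ut tx] := hP x (conj x0 xlt1).
  have -> := F_spec x0 xs ut tx (h1 x x0 x1) (h2 x x0 x2) (h3 x x0 x3).
  by rewrite mulN1r subrr.
have := asymp_eq0 dA zero ln; rewrite fpsEadd [X in _ + X]fpsEconst mulN1r.
rewrite fpsEsum => /eqP; rewrite subr_eq0 => /eqP E.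
apply: (fmorph_inj (@ratr R)); rewrite rmorph_nat rmorph_sum.
have <- : complex.Re (ag l) = (theta_coef l)%:R.
  by rewrite agE// -(rmorph_nat (real_complex R)).
rewrite -[RHS]E; apply: eq_bigr => m _.
rewrite fpsEconst -fps_map_monomial fpsEmap [LHS](rmorphM _ (coefP m)).
by congr (_ * _); apply: ratr_int.
Qed.

End Bridge.

(** * Reduction modulo p *)

Section ReductionModP.
Variable p : nat.
Hypothesis p_prime : prime p.
Local Notation Fp := 'F_p.

Lemma Fp_intr_eq0 (z : int) : (z%:~R == 0 :> Fp) = (p%:Z %| z)%Z.
Proof. by rewrite (dvdz_pcharf (pchar_Fp p_prime)). Qed.

(* Only meaningful when p_integral p x. *)
Definition reduce (x : rat) : Fp := (numq x)%:~R / (denq x)%:~R.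

(** Any fraction u / d with d prime to p computes the reduction, because the reduced denominator
    divides d. This makes [reduce] compatible with sums and products. *)
Lemma p_integral_frac (x : rat) (u d : int) :
  ~~ (p%:Z %| d)%Z -> x * d%:~R = u%:~R ->
  p_integral p x /\ reduce x * d%:~R = u%:~R.
Proof.
move=> pd xd; have E : numq x * d = u * denq x.
  apply: (@intr_inj rat); rewrite !rmorphM /= numqE -xd; ring.
have dd : (denq x %| d)%Z.
  rewrite -(@Gauss_dvdzr _ (numq x)) ?E ?dvdz_mull//.
  by rewrite coprimezE coprime_sym coprime_num_den.
have pI : p_integral p x.
  by apply: contra pd => /dvdz_trans; apply.
split=> //; have dn0 : (denq x)%:~R != 0 :> Fp by rewrite Fp_intr_eq0.
apply: (mulIf dn0); rewrite /reduce mulrAC divfK// -!rmorphM /=.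
by rewrite E.
Qed.

Lemma reduceE x : p_integral p x -> reduce x * (denq x)%:~R = (numq x)%:~R.
Proof. by move=> px; rewrite /reduce divfK// Fp_intr_eq0. Qed.

Let ndvdM (d e : int) : ~~ (p%:Z %| d)%Z -> ~~ (p%:Z %| e)%Z -> ~~ (p%:Z %| d * e)%Z.
Proof. by rewrite -!Fp_intr_eq0 rmorphM mulf_eq0 negb_or => -> ->. Qed.

Lemma reduceD x y : p_integral p x -> p_integral p y ->
  p_integral p (x + y) /\ reduce (x + y) = reduce x + reduce y.
Proof.
move=> px py; have pd := ndvdM px py.
have [|pI E] := @p_integral_frac (x + y) (numq x * denq y + numq y * denq x) _ pd.
  by rewrite rmorphD !rmorphM /= !numqE; ring.
split=> //; have dn0 : (denq x * denq y)%:~R != 0 :> Fp by rewrite Fp_intr_eq0.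
apply: (mulIf dn0); rewrite E rmorphD !rmorphM /= -(reduceE px) -(reduceE py); ring.
Qed.

Lemma reduceM x y : p_integral p x -> p_integral p y ->
  p_integral p (x * y) /\ reduce (x * y) = reduce x * reduce y.
Proof.
move=> px py; have pd := ndvdM px py.
have [|pI E] := @p_integral_frac (x * y) (numq x * numq y) _ pd.
  by rewrite !rmorphM /= !numqE; ring.
split=> //; have dn0 : (denq x * denq y)%:~R != 0 :> Fp by rewrite Fp_intr_eq0.
apply: (mulIf dn0); rewrite E !rmorphM /= -(reduceE px) -(reduceE py); ring.
Qed.

Let ndvd1 : ~~ (p%:Z %| 1)%Z.
Proof. by rewrite -Fp_intr_eq0 oner_eq0. Qed.

Lemma reduce_int (z : int) : p_integral p z%:~R /\ reduce z%:~R = z%:~R.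
Proof.
by have [pI E] := @p_integral_frac z%:~R z 1 ndvd1 (mulr1 _); rewrite mulr1 in E.
Qed.

Lemma reduce_sum (I : Type) (r : seq I) (f : I -> rat) :
  (forall i, p_integral p (f i)) ->
  p_integral p (\sum_(i <- r) f i) /\
  reduce (\sum_(i <- r) f i) = \sum_(i <- r) reduce (f i).
Proof.
move=> fI; elim: r => [|i r [IH1 IH2]].
  by rewrite !big_nil; have [? ?] := reduce_int 0.
by rewrite !big_cons -IH2; apply: reduceD.
Qed.

Lemma reduceB x y : p_integral p x -> p_integral p y ->
  reduce x = reduce y -> (p%:Z %| numq (x - y))%Z.
Proof.
move=> px py xy; have [pN EN] := reduceM (proj1 (reduce_int (-1))) py.
rewrite (proj2 (reduce_int (-1))) in EN.
have [pI E] := reduceD px pN; move: pI E; rewrite EN xy.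
rewrite [_ * y](_ : _ = - y); last by rewrite mulN1r.
move=> pI E; rewrite -Fp_intr_eq0 -(reduceE pI) E.
by rewrite mulrN1z mulN1r subrr mul0r.
Qed.

End ReductionModP.

(** * Hypergeometric coefficients *)

Lemma rising_S x n : rising x n.+1 = rising x n * (x + n%:R).
Proof. by rewrite /rising big_ord_recr. Qed.

Lemma hyp2F1_coefS a b c n : rising c n.+1 != 0 ->
  hyp2F1_coef a b c n.+1 * ((c + n%:R) * n.+1%:R) =
  hyp2F1_coef a b c n * ((a + n%:R) * (b + n%:R)).
Proof.
rewrite /hyp2F1_coef !rising_S mulf_eq0 negb_or => /andP[c0 c1].
rewrite factS natrM; have f0 : n`!%:R != 0 :> rat by rewrite pnatr_eq0 -lt0n fact_gt0.
have n0 : n.+1%:R != 0 :> rat by rewrite pnatr_eq0.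
by move: n.+1%:R n`!%:R n0 f0 => N f n0 f0; field; rewrite c0 c1 f0 n0.
Qed.

Lemma rising_neq0 x n : 0 < x -> rising x n != 0.
Proof.
move=> x0; apply/prodf_neq0 => i _; rewrite gt_eqF//.
by rewrite ltr_pwDl// ler0n.
Qed.

(* The coefficients of the series defining W, without the powers of 1728. *)
Definition W_coef (b m : nat) : rat :=
  if b == 0%N then hyp2F1_coef (- (1 / 24%:R)) (7%:R / 24%:R) (3%:R / 4%:R) m
  else hyp2F1_coef (11%:R / 24%:R) (19%:R / 24%:R) (3%:R / 4%:R) m.

Lemma W_coef0 b : W_coef b 0 = 1.
Proof.
have r0 x : rising x 0 = 1 by rewrite /rising big_ord0.
by rewrite /W_coef /hyp2F1_coef !r0 fact0 ?divr1 ?mulr1 ?divr1 ?if_same.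
Qed.

(** Scaling the ratio of consecutive hypergeometric coefficients by 576 = 24^2 produces exactly the
    factors of [kz_recurrence]. *)
Lemma W_coefS b m : (b <= 1)%N ->
  W_coef b m.+1 * (144 * m.+1%:R * (4 * m%:R + 3)) =
  W_coef b m * ((24 * m%:R + 12 * b%:R - 1) * (24 * m%:R + 12 * b%:R + 7)).
Proof.
have r0 : rising (3%:R / 4%:R) m.+1 != 0.
  by apply: rising_neq0; rewrite divr_gt0 ?ltr0n.
case: b => [|[|//]] _; rewrite /W_coef /=.
  have := hyp2F1_coefS (- (1 / 24%:R)) (7%:R / 24%:R) r0.
  move: (hyp2F1_coef _ _ _ _) (hyp2F1_coef _ _ _ _) => h h' E.
  have -> : h' * (144 * m.+1%:R * (4 * m%:R + 3)) = 576 * (h' * ((3%:R / 4%:R + m%:R) * m.+1%:R)).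
    by field.
  by rewrite E; field.
have := hyp2F1_coefS (11%:R / 24%:R) (19%:R / 24%:R) r0.
move: (hyp2F1_coef _ _ _ _) (hyp2F1_coef _ _ _ _) => h h' E.
have -> : h' * (144 * m.+1%:R * (4 * m%:R + 3)) = 576 * (h' * ((3%:R / 4%:R + m%:R) * m.+1%:R)).
  by field.
by rewrite E; field.
Qed.

Lemma coef_W b n i : (W b n)`_i = if (i <= n)%N then W_coef b (n - i) * 1728%:R ^+ (n - i) else 0.
Proof. by rewrite /W /W0 /W1 /poly_part /W_coef; case: eqP => _; rewrite coef_poly ltnS. Qed.

Section EisensteinModP.
Variable F : fieldType.
Local Notation E2 := (fps_map (intmul (1 : F)) E2_ser).
Local Notation E4 := (fps_map (intmul (1 : F)) E4_ser).
Local Notation E6 := (fps_map (intmul (1 : F)) E6_ser).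
Local Notation theta := (fps_map (intmul (1 : F)) theta_ser).

Lemma E2_map_ode : 12 * fpsD E2 = E2 ^+ 2 - E4.
Proof.
by rewrite fpsD_map -rmorphXn -rmorphB -ramanujan_E2_ser rmorphM rmorph_nat.
Qed.

Lemma E4_map_ode : 3 * fpsD E4 = E2 * E4 - E6.
Proof. by rewrite fpsD_map -rmorphM -rmorphB -ramanujan_E4_ser rmorphM rmorph_nat. Qed.

Lemma E6_map_ode : 2 * fpsD E6 = E2 * E6 - E4 ^+ 2.
Proof.
by rewrite fpsD_map -rmorphM -rmorphXn -rmorphB -ramanujan_E6_ser rmorphM rmorph_nat.
Qed.

Lemma theta_map_kz : kz_op E2 E4 theta = 0.
Proof.
move: E2_ser E4_ser theta_ser theta_ser_ode => P Q f.
pose h := fps_map (intmul (1 : F)); move=> /(congr1 h).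
have -> : h (192 * fpsD (fpsD f)) = 192 * fpsD (fpsD (h f)).
  by rewrite /h rmorphM (rmorph_nat _ 192) !fpsD_map.
rewrite (_ : h (_ - _) = h (48 * P * fpsD f) - h ((P ^+ 2 - Q) * f)); last first.
  exact: rmorphB.
have -> : h (48 * P * fpsD f) = 48 * h P * fpsD (h f).
  by rewrite /h !rmorphM (rmorph_nat _ 48) fpsD_map.
have -> : h ((P ^+ 2 - Q) * f) = (h P ^+ 2 - h Q) * h f.
  by rewrite /h rmorphM rmorphB rmorphXn.
rewrite -/(h P) -/(h Q) -/(h f); move: (h P) (h Q) (h f) => P' Q' f' E.
rewrite /kz_op; set X := 48 * P' * D f'.
set Y := (P' ^+ 2 - Q') * f'; set Z := 192 * fpsD (fpsD f').
have -> : Z = X - Y by exact: E.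
by rewrite [X - Y - X]addrAC subrr sub0r addNr.
Qed.

End EisensteinModP.

Lemma theta_coef0 : theta_coef 0 = 1%N.
Proof.
rewrite /theta_coef (@eq_card _ _ predT) ?card_ord// => i.
by rewrite !inE (ord1 i).
Qed.

Section Recurrence.
Variable b : nat.

Definition numer m : int := (24 * m%:Z + 12 * b%:Z - 1) * (24 * m%:Z + 12 * b%:Z + 7).
Definition denom m : int := 144 * m.+1%:Z * (4 * m%:Z + 3).

Lemma numer_intr (S : comNzRingType) m : (numer m)%:~R =
  (24 * m%:R + 12 * b%:R - 1) * (24 * m%:R + 12 * b%:R + 7) :> S.
Proof. by rewrite /numer !(rmorphM, rmorphD, rmorphB, rmorphN) /=. Qed.

Lemma denom_intr (S : comNzRingType) m :
  (denom m)%:~R = 144 * m.+1%:R * (4 * m%:R + 3) :> S.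
Proof. by rewrite /denom !(rmorphM, rmorphD) /=. Qed.

End Recurrence.

(** * Comparison of the two coefficient sequences modulo p *)

Section Congruence.
Variables (p n a b : nat) (c : nat -> rat).
Hypotheses (p_prime : prime p) (p_ge7 : (7 <= p)%N).
Hypothesis b_le1 : (b <= 1)%N.
Hypothesis weight : (2 * (12 * n + 4 * a + 6 * b) = p.+1)%N.
Hypothesis c_theta : forall l, (l <= n)%N ->
  \sum_(m < n.+1) c m * (wt_monomial E4_ser E6_ser n a b m l)%:~R = (theta_coef l)%:R.
Local Notation Fp := 'F_p.
Local Notation z := (wt_monomial E4_ser E6_ser n a b).
Local Notation red := (@reduce p).

Let Fp_nat_neq0 m : (0 < m)%N -> (m < p)%N -> (m%:R : Fp) != 0.
Proof.
by move=> m0 mp; rewrite [_ == 0](Fp_intr_eq0 p_prime m%:Z) unfold_in /= gtnNdvd.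
Qed.

Let small_neq0 m : (0 < m)%N -> (m <= 6)%N -> (m%:R : Fp) != 0.
Proof. by move=> m0 m6; apply: Fp_nat_neq0 => //; apply: leq_ltn_trans p_ge7. Qed.

Let F1728_neq0 : (1728%:R : Fp) != 0.
Proof.
have -> : (1728 = (2 * 2 * 2) * (2 * 2 * 2) * (3 * 3 * 3))%N by [].
by rewrite !natrM !mulf_neq0 ?small_neq0.
Qed.

Let z_ord m : fps_ord m (z m) /\ z m m = 1728%:Z ^+ m.
Proof.
have [x1 x2] := @wt_monomial_ord _ E4_ser E6_ser n a b m E4_ser0 E6_ser0 disc_ser0.
by split=> //; rewrite x2 disc_ser1.
Qed.

(** The system [c_theta] is triangular with diagonal entries 1728^m, which are prime to p, so
    forward substitution never divides by p. *)
Lemma c_p_integral m : (m <= n)%N -> p_integral p (c m).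
Proof.
elim/ltn_ind: m => m IH mn; have mn' : (m < n.+1)%N by [].
have : c m * (z m m)%:~R + \sum_(i < n.+1 | i != Ordinal mn') c i * (z i m)%:~R
    = (theta_coef m)%:R by rewrite -(c_theta mn) [RHS](bigD1 (Ordinal mn')).
rewrite (proj2 (z_ord m)).
set S := \sum_(i < _ | _) _ => E.
have pS : p_integral p S.
  rewrite /S big_mkcond.
  apply: (proj1 (reduce_sum p_prime _ _)) => i; case: eqP => [_|/eqP im].
    exact: (proj1 (reduce_int p_prime 0)).
  have [lt|ge] := ltnP i m.
    by apply: (proj1 (reduceM p_prime _ _)); [apply: IH; rewrite // ltnW// (leq_trans lt)
      | exact: (proj1 (reduce_int p_prime _))].
  rewrite (proj1 (z_ord i)) ?mulr0; first exact: (proj1 (reduce_int p_prime 0)).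
  by rewrite ltn_neqAle ge andbT eq_sym.
have [T ET pT] : exists2 T, c m * (1728%:Z ^+ m)%:~R = T & p_integral p T.
  exists ((theta_coef m)%:R + (- 1)%:~R * S); first by rewrite -E; ring.
  apply: (proj1 (reduceD p_prime _ _)); first exact: (proj1 (reduce_int p_prime (theta_coef m)%:Z)).
  by apply: (proj1 (reduceM p_prime _ _)) => //; exact: (proj1 (reduce_int p_prime _)).
have pd : ~~ (p%:Z %| 1728%:Z ^+ m * denq T)%Z.
  rewrite -(Fp_intr_eq0 p_prime) rmorphM mulf_neq0 ?(Fp_intr_eq0 p_prime)//.
  rewrite -(Fp_intr_eq0 p_prime) rmorphXn; apply: expf_neq0.
  exact: F1728_neq0.
apply: (proj1 (@p_integral_frac _ p_prime (c m) (numq T) _ pd _)).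
by rewrite rmorphM mulrA ET numqE.
Qed.

Let red_theta : fps_eqmod n
  (\sum_(m < n.+1) fps_const (red (c m)) *
     wt_monomial (fps_map (intmul (1 : Fp)) E4_ser) (fps_map (intmul (1 : Fp)) E6_ser) n a b m)
  (fps_map (intmul (1 : Fp)) theta_ser).
Proof.
move=> l ln; rewrite fpsEsum.
transitivity (red (theta_coef l)%:R); last first.
  exact: (proj2 (reduce_int p_prime (theta_coef l)%:Z)).
rewrite -(c_theta ln).
rewrite (proj2 (reduce_sum p_prime _ _)) => [|i].
  apply: eq_bigr => i _; rewrite fpsEconst -fps_map_monomial fpsEmap.
  have [_ ->] := reduceM p_prime (c_p_integral (ltn_ord i)) (proj1 (reduce_int p_prime (z i l))).
  by rewrite (proj2 (reduce_int p_prime _)).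
apply: (proj1 (reduceM p_prime (c_p_integral (ltn_ord i)) _)).
exact: (proj1 (reduce_int p_prime _)).
Qed.


Let denom_neq0 m : (m < n)%N -> (denom m)%:~R != 0 :> Fp.
Proof.
move=> mn; rewrite /denom.
have c144 : ((2 * 2 * 2 * 2 * 3 * 3)%N%:R : Fp) != 0.
  by rewrite !natrM !mulf_neq0 ?small_neq0.
have -> : 144 * m.+1%:Z * (4 * m%:Z + 3) =
    ((2 * 2 * 2 * 2 * 3 * 3) * (m.+1 * (4 * m + 3)))%N%:Z by lia.
rewrite -pmulrn natrM mulf_neq0// natrM.
(* The weight equation gives 24 n <= p + 1, so m + 1 and 4 m + 3 lie strictly between 0 and p. *)
by apply: mulf_neq0; apply: Fp_nat_neq0; lia.
Qed.

Let red_c0 : red (c 0) = 1.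
Proof.
have := c_theta (leq0n n); rewrite theta_coef0 big_ord_recl big1 => [|i _].
  rewrite addr0 => E; have {E} : c 0 * (z 0 0%N)%:~R = 1 := E.
  rewrite (proj2 (z_ord 0)) expr0 mulr1 => ->.
  exact: (proj2 (reduce_int p_prime 1)).
by rewrite (proj1 (z_ord _)) ?mulr0.
Qed.

Let red_cS m : (m < n)%N -> red (c m.+1) * (denom m)%:~R = red (c m) * (numer b m)%:~R.
Proof.
move=> mn.
have h2 : (2 * (12 * n + 4 * a + 6 * b))%:R = 1 :> Fp.
  by rewrite weight -natr1 pchar_Fp_0// add0r.
have V0 : (fps_map (intmul (1 : Fp)) E4_ser ^+ 3
    - fps_map (intmul (1 : Fp)) E6_ser ^+ 2) 0%N = 0.
  by rewrite -!rmorphXn -rmorphB fpsEmap disc_ser0.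
have V1 : (fps_map (intmul (1 : Fp)) E4_ser ^+ 3
    - fps_map (intmul (1 : Fp)) E6_ser ^+ 2) 1%N != 0.
  by rewrite -!rmorphXn -rmorphB fpsEmap disc_ser1.
have Q0 : fps_map (intmul (1 : Fp)) E4_ser 0%N = 1 by rewrite fpsEmap E4_ser0.
have R0 : fps_map (intmul (1 : Fp)) E6_ser 0%N = 1 by rewrite fpsEmap E6_ser0.
rewrite denom_intr numer_intr.
exact: (@kz_recurrence _ _ _ _ (E2_map_ode Fp) (E4_map_ode Fp) (E6_map_ode Fp)
  n a b b_le1 Q0 R0 V0 V1 h2 _ (fun m => red (c m)) (theta_map_kz Fp) red_theta m mn).
Qed.

(** Both sequences start at 1 and obey the same recurrence; integrality of [W_coef] is carried along
    because each step divides by a unit modulo p. *)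
Lemma red_c_W m : (m <= n)%N -> p_integral p (W_coef b m) /\ red (c m) = red (W_coef b m).
Proof.
elim: m => [|m IH] mn.
  by rewrite W_coef0 red_c0; have [? ->] := reduce_int p_prime 1.
have [pW eW] := IH (ltnW mn).
have WS : W_coef b m.+1 * (denom m)%:~R = W_coef b m * (numer b m)%:~R.
  by rewrite denom_intr numer_intr W_coefS.
have pd : ~~ (p%:Z %| denom m * denq (W_coef b m))%Z.
  by rewrite -(Fp_intr_eq0 p_prime) rmorphM mulf_neq0 ?denom_neq0 ?(Fp_intr_eq0 p_prime).
have [|pI E] := @p_integral_frac _ p_prime (W_coef b m.+1) (numq (W_coef b m) * numer b m) _ pd.
  rewrite (rmorphM _ (denom m) (denq _)) (rmorphM _ (numq _) (numer b m)) /=.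
  by rewrite mulrA WS numqE mulrAC.
split=> //.
have [_ E1] := reduceM p_prime pI (proj1 (reduce_int p_prime (denom m))).
have [_ E2] := reduceM p_prime pW (proj1 (reduce_int p_prime (numer b m))).
apply: (mulIf (denom_neq0 mn)); rewrite red_cS// eW.
move: E1 E2; rewrite !(proj2 (reduce_int p_prime _)) => <- <-.
by rewrite WS.
Qed.

End Congruence.

Theorem theorem1p6 (R : realType) (p : nat) (p_prime : prime p)
    (p_ge7 : (7 <= p)%N) (p_mod4 : p = 3 %[mod 4])
    (k : nat) (k_def : k = ((p + 1) %/ 2)%N)
    (g : R[i] -> R[i]) (P : {poly rat})
    (g_def : is_modular_truncation k (fun n => (theta_coef n)%:R) g)
    (P_def : is_jpoly k g P) :
  poly_congr p P (W (wt_b k) (wt_n k)).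
Proof.
have k4 : (4 <= k)%N by lia.
have ko : ~~ odd k by lia.
have [kE _ b1] := weight_decomp ko k4.
have weight : (2 * (12 * wt_n k + 4 * wt_a k + 6 * wt_b k) = p.+1)%N by lia.
have cE := jpoly_theta_rat g_def P_def.
pose c m : rat := P`_(wt_n k - m) / 1728%:R ^+ m.
have [_ sP _] := P_def; move=> i; rewrite coef_W.
have [Z0 _] := reduce_int p_prime 0.
case: leqP => [ik|ik]; last first.
  by rewrite nth_default ?subrr//; apply: leq_trans sP ik.
have mk : (wt_n k - i <= wt_n k)%N by apply: leq_subr.
have pc := c_p_integral p_prime p_ge7 (c := c) cE mk.
have [pW rW] := red_c_W p_prime p_ge7 b1 weight (c := c) cE mk.
have [pK _] := reduce_int p_prime (1728 ^+ (wt_n k - i)).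
have KE : (1728 ^+ (wt_n k - i))%:~R = 1728%:R ^+ (wt_n k - i) :> rat by rewrite rmorphXn.
rewrite KE in pK; have K0 : 1728%:R != 0 :> rat by rewrite pnatr_eq0.
(* The coefficient of j^i in W carries the same power of 1728, so only [c] and [W_coef] remain to be
   compared. *)
have -> : P`_i = c (wt_n k - i)%N * 1728%:R ^+ (wt_n k - i).
  by rewrite /c (subKn ik) (divfK (expf_neq0 _ K0)).
move: (1728%:R ^+ _) pK => K pK.
have [p1 r1] := reduceM p_prime pc pK; have [p2 r2] := reduceM p_prime pW pK.
split; [exact: p1 | exact: p2 | apply: (reduceB p_prime p1 p2)].
by rewrite r1 r2 rW.
Qed.
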